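(* Let $P(x)$ be a polynomial with distinct roots $r_1,\dots,r_n$ and let $Q$ be its Galois group. (1) Suppose $Q$ has a composition series $1\triangleleft\dots\triangleleft C\triangleleft B\triangleleft A\triangleleft Q$, each group normal in the next, with cyclic quotient groups $Q/A=Z_a$, $A/B=Z_b$, $B/C=Z_c,\dots$ ($Z_k$ being the cyclic group of order $k$). Then $P$ has the solution in radicals $$Q_i=\left(A_{p_{1i}}+\alpha_a A_{p_{2i}}+\dots+\alpha_a^{a-1}A_{p_{ai}}\right)^a,$$ $$A_i=\left(B_{p_{1i}}+\alpha_b B_{p_{2i}}+\dots+\alpha_b^{b-1}B_{p_{bi}}\right)^b,$$ $$B_i=\left(C_{p_{1i}}+\alpha_c C_{p_{2i}}+\dots+\alpha_c^{c-1}C_{p_{ci}}\right)^c,$$ and so on down to the bottom level $$Z_i=r_{p_{1i}}+q_1 r_{p_{2i}}+\dots+q_{n-1}r_{p_{ni}}.$$ Here the top level functions $Q_i$ are expressible in terms of the coefficients of $P$; the functions $A_i,B_i,\dots$ are invariant under the permutations of the groups $A,B,\dots$ respectively, and are obtained from $A_1,B_1,\dots$ by successive application of the single permutation (belonging to the quotient group $Z_a,Z_b,\dots$ respectively) by which one passes from one presentation (coset) of the group to the next; the indices $p_{ij}$ designate the elements of that cyclic permutation; $\alpha_k$ denotes a $k$-th root of unity; and the constants $q_i$ are chosen so that the linear combinations $Z_i$ of the roots are invariant only under the identity. (2) Conversely, let $q(V)$ be an irreducible factor of the auxiliary polynomial of $P$, and let the roots of an irreducible equation $r^p=A$, with $p$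 prime, be adjoined, taking the primes in increasing order from $p=2$, until $q(V)$ reduces. Then the adjunction of the roots of $r^p=A$ to $q(V)$ reduces its Galois group to a normal subgroup, with a cyclic quotient group of prime order. Consequently any solution of $P$ in radicals must necessarily be of the form described in (1); if the Galois group of $P$ admits no composition series as in (1), no solution in radicals can be obtained at all.
   Context: A quantity is ''known'' if it can be calculated rationally from the polynomial coefficients (together with any adjoined quantities). The Galois group of a polynomial is the maximum group of permutations of its roots under which any function of the roots must be invariant for it to be a known function of the polynomial coefficients. A solution in radicals is an expression for the roots built from rational functions of the coefficients by finitely many (possibly nested) root extractions. A resolvent of $P$ is a linear function $V(r_1,\dots,r_n)=a_1r_1+\dots+a_nr_n$ of the roots, no two of whose values are equal when the roots are permuted; the auxiliary polynomial of $P$ is the monic polynomial whose roots are the $n!$ values of the resolvent under permutations of the roots. A polynomial is irreducible if it cannot be factored into lower degree polynomials whose coefficients are rational functions of the original coefficients (and of the quantities already adjoined). Adjoining a radical means allowing coefficients to be rational functions of that radical as well. In (2), the quantity $A$ in $r^p=A$ is any radical expression in the coefficients (not the group $A$ of (1)); only prime $p$ need be considered since every root extraction decomposes into extractions of prime roots, and the $p$-th roots of unity are themselves expressible in radicals with the maximum root extracted being $p-1$. *)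

(* Defs.v *)
From HB Require Import structures.
From mathcomp Require Import all_boot all_order all_algebra all_fingroup.
From mathcomp Require Import all_solvable.

Set Implicit Arguments.
Unset Strict Implicit.
Unset Printing Implicit Defensive.

Import GRing.Theory.
Local Open Scope ring_scope.

(* All quantities live in one algebraically closed field L (the complex       *)
(* numbers, say).  A set of quantities is a predicate S : L -> Prop, and      *)
(* "known, given S" means lying in the subfield generated by S.               *)

Inductive rational (L : fieldType) (S : L -> Prop) : L -> Prop :=
| rational_gen x : S x -> rational S x
| rational_one : rational S 1
| rational_sub x y : rational S x -> rational S y -> rational S (x - y)
| rational_div x y : rational S x -> rational S y -> rational S (x / y).

(* n = 0 is excluded since y ^+ 0 = 1 would make every y a radical. *)
Inductive radical (L : fieldType) (S : L -> Prop) : L -> Prop :=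
| radical_gen x : S x -> radical S x
| radical_one : radical S 1
| radical_sub x y : radical S x -> radical S y -> radical S (x - y)
| radical_div x y : radical S x -> radical S y -> radical S (x / y)
| radical_root n x y : (0 < n)%N -> radical S x -> y ^+ n = x -> radical S y.

Definition coefs (L : fieldType) (P : {poly L}) : L -> Prop :=
  fun x => x \in (P : seq L).

Definition roots_of (L : fieldType) (n : nat) (P : {poly L})
    (r : 'I_n -> L) : Prop :=
  [/\ P != 0, injective r & P = lead_coef P *: \prod_i ('X - (r i)%:P)].

(* An arrangement of n quantities is a map x : 'I_n -> L; s permutes the      *)
(* positions.  As (s * t)%g i = t (s i), permuting by t and then by s is      *)
(* permuting by (s * t)%g.                                                    *)
Definition arrange (L : Type) (n : nat) (s : 'S_n) (x : 'I_n -> L) : 'I_n -> L :=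
  fun i => x (s i).

Definition linear_function (L : fieldType) (n : nat) (a : 'I_n -> L)
    (x : 'I_n -> L) : L := \sum_i a i * x i.

(* Rational functions of n arguments with coefficients in K; the inverse of   *)
(* 0 is 0, a convention that every field automorphism respects.               *)
Inductive rational_function (L : fieldType) (n : nat) (K : L -> Prop) :
    (('I_n -> L) -> L) -> Prop :=
| ratfun_const c : K c -> rational_function K (fun=> c)
| ratfun_arg i : rational_function K (fun x => x i)
| ratfun_add f g : rational_function K f -> rational_function K g ->
    rational_function K (fun x => f x + g x)
| ratfun_mul f g : rational_function K f -> rational_function K g ->
    rational_function K (fun x => f x * g x)
| ratfun_opp f : rational_function K f -> rational_function K (fun x => - f x)
| ratfun_inv f : rational_function K f ->
    rational_function K (fun x => (f x)^-1).

Definition known_are_invariant (L : fieldType) (n : nat) (K : L -> Prop)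
    (r : 'I_n -> L) (G : {set 'S_n}) : Prop :=
  forall f, rational_function K f -> K (f r) ->
  forall s, s \in G -> f (arrange s r) = f r.

(* The Galois group, over the known field K, of the polynomial with roots r:  *)
(* the largest group of permutations of the roots under which a function of   *)
(* the roots has to be invariant in order to be known.                        *)
Definition galois_group (L : fieldType) (n : nat) (K : L -> Prop)
    (r : 'I_n -> L) (G : {group 'S_n}) : Prop :=
  known_are_invariant K r G /\
  forall H : {group 'S_n}, known_are_invariant K r H -> H \subset G.

Definition is_resolvent (L : fieldType) (n : nat) (K : L -> Prop)
    (r a : 'I_n -> L) : Prop :=
  (forall i, K (a i)) /\
  injective (fun s : 'S_n => linear_function a (arrange s r)).

Definition auxiliary_poly (L : fieldType) (n : nat) (r a : 'I_n -> L) : {poly L} :=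
  \prod_(s : 'S_n) ('X - (linear_function a (arrange s r))%:P).

Definition coefs_in (L : fieldType) (K : L -> Prop) (p : {poly L}) : Prop :=
  forall i, K p`_i.

Definition irreducible_over (L : fieldType) (K : L -> Prop) (p : {poly L}) : Prop :=
  [/\ coefs_in K p, (1 < size p)%N &
      ~ exists f g : {poly L}, [/\ coefs_in K f, coefs_in K g,
          (size f < size p)%N, (size g < size p)%N & p = f * g]].

(* Adjoining all the roots of X^p = A, for the successive pairs (p, A) of s.  *)
Fixpoint adjoin (L : fieldType) (S : L -> Prop) (s : seq (nat * L)) : L -> Prop :=
  if s is (p, A) :: s' then adjoin (fun x => S x \/ x ^+ p = A) s' else S.

(* Each A must be known, and X^p = A irreducible, at the time of adjunction.  *)
Fixpoint irreducible_adjunctions (L : fieldType) (S : L -> Prop)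
    (s : seq (nat * L)) : Prop :=
  if s is (p, A) :: s' then
    [/\ prime p, rational S A, irreducible_over (rational S) ('X^p - A%:P) &
        irreducible_adjunctions (fun x => S x \/ x ^+ p = A) s']
  else True.

Definition increasing_adjunctions (L : fieldType) (S : L -> Prop)
    (s : seq (nat * L)) : Prop :=
  irreducible_adjunctions S s /\ sorted leq (unzip1 s).

(* s lists the groups A, B, C, ..., 1 below Q. *)
Definition cyclic_series (n : nat) (Q : {group 'S_n}) (s : seq {group 'S_n}) : bool :=
  path (fun G H : {group 'S_n} => (H <| G)%g && cyclic (G / H)%g) Q s
  && (last Q s :==: 1)%g.

(* The k-th group of the series, so that Q, A, B, ... are at k = 0, 1, 2, ... *)
Definition level_group (n : nat) (Q : {group 'S_n}) (s : seq {group 'S_n})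
    (k : nat) : {group 'S_n} := nth 1%G (Q :: s) k.

Definition level_index (n : nat) (Q : {group 'S_n}) (s : seq {group 'S_n})
    (k : nat) : nat := #|level_group Q s k : level_group Q s k.+1|%g.

(* f_1 + w f_2 + ... + w^(N-1) f_N, where f_1 is the value of f at the        *)
(* arrangement x and each next value is obtained by applying g.               *)
Definition lagrange_sum (L : fieldType) (n N : nat) (g : 'S_n) (w : L)
    (f : ('I_n -> L) -> L) (x : 'I_n -> L) : L :=
  \sum_(j < N) w ^+ j * f (arrange (g ^+ j)%g x).

(* The function at level k when d levels remain below it: Z at the bottom,    *)
(* and the a_k-th power of a Lagrange sum of the next function above it.      *)
Fixpoint lagrange_tower (L : fieldType) (n : nat) (a : nat -> nat)
    (g : nat -> 'S_n) (alpha : nat -> L) (q : 'I_n -> L) (d k : nat) :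
    ('I_n -> L) -> L :=
  if d is d'.+1 then
    fun x => lagrange_sum (a k) (g k) (alpha k)
               (lagrange_tower a g alpha q d' k.+1) x ^+ a k
  else linear_function q.

(* The functions Q, A, B, ..., Z of the roots are level_function at           *)
(* k = 0, 1, 2, ..., size s; the quantity written A_i (or B_i, ...) is the    *)
(* value of the corresponding function at the i-th arrangement.               *)
Definition level_function (L : fieldType) (n : nat) (Q : {group 'S_n})
    (s : seq {group 'S_n}) (g : nat -> 'S_n) (alpha : nat -> L)
    (q : 'I_n -> L) (k : nat) : ('I_n -> L) -> L :=
  lagrange_tower (level_index Q s) g alpha q (size s - k) k.

(* g k is the single permutation by which one passes from one coset of the    *)
(* (k+1)-st group in the k-th group to the next.                              *)
Definition coset_generators (n : nat) (Q : {group 'S_n}) (s : seq {group 'S_n})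
    (g : nat -> 'S_n) : Prop :=
  forall k, (k < size s)%N ->
    let G := level_group Q s k in
    let H := level_group Q s k.+1 in
    g k \in G /\ (G / H)%g = <[coset H (g k)]>%g.

Definition roots_of_unity (L : fieldType) (n : nat) (Q : {group 'S_n})
    (s : seq {group 'S_n}) (alpha : nat -> L) : Prop :=
  forall k, (k < size s)%N -> alpha k ^+ level_index Q s k = 1.

(* Z_i = r_1 + q_1 r_2 + ... at each arrangement of the roots in Q, with      *)
(* known constants, is to be invariant only under the identity.               *)
Definition bottom_constants (L : fieldType) (n : nat) (K : L -> Prop)
    (r : 'I_n -> L) (Q : {group 'S_n}) (q : 'I_n -> L) : Prop :=
  [/\ forall i, K (q i),
      forall i : 'I_n, val i = 0%N -> q i = 1 &
      forall t s : 'S_n, t \in Q ->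
        linear_function q (arrange s (arrange t r)) =
          linear_function q (arrange t r) -> s = 1%g].

(* What it means for the tower of functions to solve P in radicals: suitable  *)
(* constants q exist, and for all of them, all coset generators and all       *)
(* choices of the roots of unity,                                             *)
(* - the functions are linked by the formulas of the solution;                *)
(* - each function is invariant under its group;                              *)
(* - the top values are expressible by the coefficients (and the alpha_k);    *)
(* - the values at level k+1 are expressible by the a_k-th roots of the       *)
(*   values at level k, formed with every a_k-th root of unity w in the place *)
(*   of alpha_k (one such w gives one linear equation for f_1, ..., f_(a_k),  *)
(*   and all of them are needed to solve for these);                          *)
(* - the roots of P are expressible by the bottom values Z_i.                 *)
Definition tower_solution (L : fieldType) (n : nat) (P : {poly L})
    (r : 'I_n -> L) (Q : {group 'S_n}) (s : seq {group 'S_n}) : Prop :=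
  let constants := bottom_constants (rational (coefs P)) r Q in
  [/\ exists q, constants q,
      forall (q : 'I_n -> L) (g : nat -> 'S_n) (alpha : nat -> L),
        constants q -> coset_generators Q s g -> roots_of_unity Q s alpha ->
        let F := level_function Q s g alpha q in
        let a := level_index Q s in
        [/\ (forall k, (k < size s)%N -> forall x,
               F k x = (\sum_(j < a k)
                 alpha k ^+ j * F k.+1 (arrange (g k ^+ j)%g x)) ^+ a k) /\
            (forall x, F (size s) x = \sum_i q i * x i),
            forall k, (k <= size s)%N -> forall x t,
              t \in level_group Q s k -> F k (arrange t x) = F k x,
            forall t, t \in Q ->
              rational (fun z => coefs P z \/
                                 exists2 k, (k < size s)%N & z = alpha k)
                       (F 0%N (arrange t r)),
            forall k, (k < size s)%N -> forall t, t \in Q ->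
              rational (fun z => coefs P z \/
                          exists2 w, w ^+ a k = 1 & z = w \/
                            z ^+ a k = level_function Q s g
                              [eta alpha with k |-> w] q k (arrange t r))
                       (F k.+1 (arrange t r)) &
            forall i,
              rational (fun z => coefs P z \/
                          exists2 t, t \in Q & z = F (size s) (arrange t r))
                       (r i)] &
      forall i, radical (coefs P) (r i)].

(* Main.v *)
Require Import Defs.
From HB Require Import structures.
From mathcomp Require Import all_boot all_order all_algebra all_fingroup.
From mathcomp Require Import all_solvable.
From mathcomp Require Import separable.
From mathcomp Require cyclotomic.
From mathcomp Require Import boolp.
From mathcomp Require Import mpoly.

Set Implicit Arguments.
Unset Strict Implicit.
Unset Printing Implicit Defensive.

Import GRing.Theory.
Local Open Scope ring_scope.

(* The theory is Lagrange's and Galois' own: fields are sets of known         *)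
(* quantities inside L, and a permutation belongs to the group of a tuple v   *)
(* when it preserves every rational relation of v.  Lagrange interpolation at *)
(* the n! values of a resolvent expresses every function of v as a polynomial *)
(* in one of these values; comparing with its minimal polynomial shows that   *)
(* the functions invariant under the group are exactly the known ones.        *)
(*                                                                            *)
(* (1) The a-th power of a Lagrange sum is invariant under the larger group,  *)
(* and averaging the sums over all a-th roots of unity recovers the function. *)
(*                                                                            *)
(* (2) When the p-th roots of unity are known, adjoining a p-th root y leaves *)
(* the group unchanged, or else y = g(v) is a function of the roots and       *)
(* s |-> g(s v)/y is a character of order p whose kernel is the new group.    *)
(* The p-th roots of unity have fewer than p conjugates, so they come from    *)
(* adjunctions of smaller primes; doing this in increasing order, before any  *)
(* p-th root is adjoined, makes every adjunction one of this kind.            *)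

(** * Subfields *)

(** For a tuple [v] whose monic polynomial has coefficients in [K], [gal K v] consists of the
    permutations that preserve every relation [f v = 0] over [K]; it is the Galois group of the
    theorem ([galois_group_gal]). Everything rests on resolvents. One value of a resolvent
    determines all the roots ([resolvent_inversion]), and its conjugates are its values at the group
    elements ([minimal_poly_resolvent]), so a function invariant under the group is known
    ([gal_invariant_known]). Fields are thereby compared through groups: passing from [K] to [K']
    keeps the group iff [K(v)] and [K'] share only elements of [K] ([gal_eqP]), and a nonconstant
    factor over [K] of the auxiliary polynomial is irreducible iff its degree is the group order
    ([irreducible_auxiliary_factor]).

    Part (1): the larger group at a level merely multiplies a Lagrange sum by roots of unity, so the
    power of the sum is invariant ([lagrange_sum_invariant]) and the top values are known. Adding
    the sums over all roots of unity undoes a level ([lagrange_sum_inversion]), and the bottom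
    values, fixed only by the identity, generate the roots ([root_rational_bottom]).

    Part (2): when the [p]-th roots of unity are known, a [p]-th root that changes the group is a
    function of [v], and the factors by which the group multiplies it form a character whose kernel
    is the new group ([kummer_step]). The roots of unity themselves come from radicals of smaller
    prime degree ([kummer_refinement]), which leave [q] irreducible by hypothesis; this gives
    [one_adjunction]. Any radical expression lies at the end of a chain of such Kummer adjunctions
    ([radical_kummer]), whose successive groups form a series with prime cyclic quotients
    ([kummer_cyclic_series]). Unsolvability is the contrapositive. *)

Definition known (L : fieldType) (S : L -> Prop) : {pred L} :=
  fun x => `[< rational S x >].

Lemma knownP (L : fieldType) (S : L -> Prop) x :
  reflect (rational S x) (x \in known S).
Proof. exact: asboolP. Qed.

Lemma known_divring_closed (L : fieldType) (S : L -> Prop) :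
  divring_closed (known S).
Proof.
split=> [|x y /knownP Sx /knownP Sy|x y /knownP Sx /knownP Sy]; apply/knownP.
- exact: rational_one.
- exact: rational_sub.
- exact: rational_div.
Qed.

HB.instance Definition _ (L : fieldType) (S : L -> Prop) :=
  GRing.isDivringClosed.Build L (known S) (known_divring_closed S).

Lemma knownE (L : fieldType) (S : L -> Prop) :
  (fun x => is_true (x \in known S)) = rational S.
Proof. by rewrite predeqE => x; split=> /knownP. Qed.

Section SubfieldType.
Variables (L : fieldType) (K : divringClosed L).

(** A field type of its own, so that division, gcd and Bezout for polynomials over [K] are carried
    out there and mapped back to [L]. *)
Definition subfield_type := {x : L | x \in K}.
HB.instance Definition _ := SubType.on subfield_type.
HB.instance Definition _ := [Choice of subfield_type by <:].
HB.instance Definition _ :=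
  [SubChoice_isSubIntegralDomain of subfield_type by <:].
HB.instance Definition _ := [SubIntegralDomain_isSubField of subfield_type
  by <:].

Lemma polyOver_lift (p : {poly L}) :
  p \is a polyOver K -> exists p0 : {poly subfield_type}, p = map_poly val p0.
Proof.
move=> /polyOverP Kp.
exists (\poly_(i < size p) (exist _ p`_i (Kp i) : subfield_type)).
apply/polyP=> i; rewrite coef_map coef_poly /=.
by case: ltnP => // /(nth_default 0) ->.
Qed.

Lemma polyOver_map_val (p : {poly subfield_type}) :
  map_poly val p \is a polyOver K.
Proof. by apply/polyOverP=> i; rewrite coef_map; apply: valP. Qed.

Lemma polyOver_modp : {in polyOver K &, forall p q, p %% q \is a polyOver K}.
Proof.
move=> _ _ /polyOver_lift[p ->] /polyOver_lift[q ->].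
by rewrite -map_modp polyOver_map_val.
Qed.

Lemma polyOver_divp : {in polyOver K &, forall p q, p %/ q \is a polyOver K}.
Proof.
move=> _ _ /polyOver_lift[p ->] /polyOver_lift[q ->].
by rewrite -map_divp polyOver_map_val.
Qed.

Lemma polyOver_gcdp : {in polyOver K &, forall p q, gcdp p q \is a polyOver K}.
Proof.
move=> _ _ /polyOver_lift[p ->] /polyOver_lift[q ->].
by rewrite -gcdp_map polyOver_map_val.
Qed.

Lemma polyOver_Bezout p q : p \is a polyOver K -> q \is a polyOver K ->
  coprimep p q ->
  exists u v, [/\ u \is a polyOver K, v \is a polyOver K & u * p + v * q = 1].
Proof.
move=> /polyOver_lift[p0 ->] /polyOver_lift[q0 ->].
rewrite coprimep_map => /Bezout_eq1_coprimepP[[u v] /= uv1].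
exists (map_poly val u), (map_poly val v); split; try exact: polyOver_map_val.
by rewrite -!rmorphM -rmorphD uv1 rmorph1.
Qed.

Definition minimal_poly (x : L) (m : {poly L}) : Prop :=
  [/\ m \is a polyOver K, m \is monic, root m x &
      forall g, g \is a polyOver K -> root g x -> m %| g].

Lemma minimal_poly_exists (x : L) (P : {poly L}) :
  P \is a polyOver K -> P != 0 -> root P x -> exists m, minimal_poly x m.
Proof.
move=> KP nzP Px.
pose S k := `[< exists p : {poly L},
  [/\ p \is a polyOver K, p != 0, root p x & size p = k] >].
have exS : exists k, S k by exists (size P); apply/asboolP; exists P.
case: (ex_minnP exS) => k /asboolP[p [Kp nzp px <-]] minp.
exists ((lead_coef p)^-1 *: p); split.
- by apply: polyOverZ => //; rewrite rpredV; apply/polyOverP.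
- by rewrite monicE lead_coefZ mulVf ?lead_coef_eq0.
- by rewrite rootZ // invr_eq0 lead_coef_eq0.
move=> g Kg gx; rewrite dvdpZl ?invr_eq0 ?lead_coef_eq0 //.
apply: contraT => ndv.
have /minp : S (size (g %% p)).
  apply/asboolP; exists (g %% p); split=> //; first exact: polyOver_modp.
  rewrite /root; have := gx; rewrite /root {1}(divp_eq g p) hornerD hornerM.
  by rewrite (eqP px) mulr0 add0r.
by rewrite leqNgt ltn_modp nzp.
Qed.

(** The gcd does not vanish at [x], so its cofactor in [m] does; by minimality [m] divides that
    cofactor, which leaves a constant gcd. *)
Lemma minimal_poly_coprime x m h : minimal_poly x m ->
  h \is a polyOver K -> ~~ root h x -> coprimep m h.
Proof.
move=> [Km monm mx minm] Kh nhx.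
have gm := dvdp_gcdl m h.
have Kg : gcdp m h \is a polyOver K by apply: polyOver_gcdp.
have ngx : ~~ root (gcdp m h) x by rewrite root_gcd mx.
have mE : m = m %/ gcdp m h * gcdp m h by rewrite divpK.
have dvx : root (m %/ gcdp m h) x.
  by move: mx; rewrite {1}mE rootM (negbTE ngx) orbF.
have nzm := monic_neq0 monm.
have := minm _ (polyOver_divp Km Kg) dvx.
move=> /dvdp_leq; rewrite dvdp_div_eq0 // nzm => /(_ isT).
rewrite size_divp ?gcdp_eq0 ?negb_and ?nzm // /coprimep => le.
have sg : (0 < size (gcdp m h))%N
  by rewrite size_poly_gt0 gcdp_eq0 negb_and nzm.
have sm : (0 < size m)%N by rewrite size_poly_gt0.
case: (size (gcdp m h)) sg le => // [[|k]] //= _.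
by rewrite leqNgt ltn_subrL sm.
Qed.

(** Bezout gives one polynomial that inverts [h] at all conjugates of [x] at once; this eliminates
    division from rational functions. *)
Lemma minimal_poly_inv x m h : minimal_poly x m ->
  h \is a polyOver K -> ~~ root h x ->
  exists2 u, u \is a polyOver K & forall z, root m z -> u.[z] = h.[z]^-1.
Proof.
move=> mP Kh nhx; have cop := minimal_poly_coprime mP Kh nhx.
have [Km _ _ _] := mP.
have [u [v [_ Kv uv1]]] := polyOver_Bezout Km Kh cop.
exists v => // z /eqP mz.
have := congr1 (fun p => p.[z]) uv1;
  rewrite hornerD !hornerM mz mulr0 add0r hornerC.
move=> vh; have nz : h.[z] != 0.
  by apply: contra_eqN vh => /eqP->; rewrite mulr0 eq_sym oner_eq0.
by apply: (mulIf nz); rewrite vh mulVf.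
Qed.

End SubfieldType.

(** * Resolvents and symmetric functions *)

Section SymmetricFunctions.
Variables (L : fieldType) (K : divringClosed L) (n : nat) (v : 'I_n -> L).
Hypothesis Kv : \prod_i ('X - (v i)%:P) \is a polyOver K.
Local Notation F := (subfield_type K).

(** Symmetry is a property of formal polynomials, not of their values at [v]; hence the detour
    through [{mpoly F[n]}]. *)
Definition eval_known : {mpoly F[n]} -> L := mmap (\val : F -> L) v.
HB.instance Definition _ :=
  GRing.RMorphism.copy eval_known (mmap (\val : F -> L) v).
Local Notation ev := eval_known.

Lemma eval_knownC c : ev c%:MP = \val c.
Proof. exact: mmapC. Qed.

Lemma eval_knownX i : ev 'X_i = v i.
Proof. by rewrite /eval_known mmapX mmap1U. Qed.

Lemma eval_known_mesym (k : 'I_n) : ev (mesym n F k.+1) \in K.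
Proof.
have -> : ev (mesym n F k.+1) = (mesym n L k.+1).@[v].
  rewrite !mesymE !rmorph_sum; apply: eq_bigr => h _.
  by rewrite /= /meval [RHS]mmapX [LHS]mmapX.
have := mroots_coeff [tuple v i | i < n] (lift ord0 k).
rewrite /= big_image /= (_ : bump 0 k = k.+1) //.
rewrite (@meval_eq _ _ (tnth [tuple v i | i < n]) v); last first.
  by move=> i; rewrite tnth_mktuple.
move=> E; suff -> : (mesym n L k.+1).@[v] =
    (-1) ^+ k.+1 * (\prod_i ('X - (v i)%:P))`_(n - k.+1).
  by rewrite rpredM ?rpredX ?rpredN ?rpred1 //; apply/polyOverP.
by rewrite E mulrA -exprD addnn -mul2n exprM sqrrN expr1n expr1n mul1r.
Qed.

Lemma eval_known_symmetric (f : {mpoly F[n]}) : f \is symmetric -> ev f \in K.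
Proof.
move=> /sym_fundamental[t [<- _]].
rewrite /comp_mpoly /mmap rmorph_sum rpred_sum // => m _.
rewrite rmorphM /= eval_knownC rpredM //; first exact: valP.
rewrite /mmap1 rmorph_prod rpred_prod // => i _.
by rewrite rmorphXn rpredX //= tnth_mktuple eval_known_mesym.
Qed.

Lemma map_symmetric_poly_known (p : {poly {mpoly F[n]}}) :
  (forall t, map_poly (msym t) p = p) -> map_poly ev p \is a polyOver K.
Proof.
move=> sym_p; apply/polyOverP=> i; rewrite coef_map /=.
by apply/eval_known_symmetric/issymP => t; rewrite -[in RHS](sym_p t) coef_map.
Qed.

Variable a : 'I_n -> L.
Hypothesis Ka : forall i, a i \in K.
Local Notation theta s := (linear_function a (arrange s v)).

Let Theta (s : 'S_n) : {mpoly F[n]} :=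
  \sum_i (exist _ (a i) (Ka i) : F)%:MP * 'X_(s i).

Let msym_Theta s t : msym t (Theta s) = Theta (s * t)%g.
Proof.
rewrite rmorph_sum; apply: eq_bigr => i _.
by rewrite rmorphM /= /msym mmapC mmapX mmap1U permM.
Qed.

Let ev_Theta s : ev (Theta s) = theta s.
Proof.
rewrite rmorph_sum; apply: eq_bigr => i _.
by rewrite rmorphM /= eval_knownC eval_knownX.
Qed.

Lemma auxiliary_poly_known : auxiliary_poly v a \is a polyOver K.
Proof.
have -> : auxiliary_poly v a = map_poly ev (\prod_s ('X - (Theta s)%:P)).
  rewrite rmorph_prod; apply: eq_bigr => s _.
  by rewrite rmorphB /= map_polyX map_polyC /= ev_Theta.
apply: map_symmetric_poly_known => t; rewrite rmorph_prod.
rewrite [RHS](reindex_inj (mulIg t)); apply: eq_bigr => s _.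
by rewrite rmorphB /= map_polyX map_polyC /= msym_Theta.
Qed.

(** The numerator of Lagrange's interpolation formula; [interp 1] is the derivative of the auxiliary
    polynomial and serves as the denominator. *)
Let interp (f : {mpoly F[n]}) :=
  \sum_s (ev (msym s f))%:P * \prod_(u | u != s) ('X - (theta u)%:P).

Let interp_known f : interp f \is a polyOver K.
Proof.
pose g := \sum_s (msym s f)%:P * \prod_(u | u != s) ('X - (Theta u)%:P).
have -> : interp f = map_poly ev g.
  rewrite rmorph_sum; apply: eq_bigr => s _.
  rewrite rmorphM rmorph_prod /= map_polyC; congr (_ * _).
  by apply: eq_bigr => u _; rewrite rmorphB /= map_polyX map_polyC /= ev_Theta.
apply: map_symmetric_poly_known => t; rewrite rmorph_sum.
rewrite [RHS](reindex_inj (mulIg t)); apply: eq_bigr => s _.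
rewrite rmorphM rmorph_prod /= map_polyC /= -msymMm; congr (_ * _).
rewrite [RHS](reindex_inj (mulIg t)); apply: eq_big => u.
  by rewrite (inj_eq (mulIg t)).
by rewrite rmorphB /= map_polyX map_polyC /= msym_Theta.
Qed.

Let interpE f s : (interp f).[theta s] =
  ev (msym s f) * \prod_(u | u != s) (theta s - theta u).
Proof.
rewrite horner_sum (bigD1 s) //= [X in _ + X]big1 ?addr0 => [|u us].
  rewrite hornerM hornerC horner_prod; congr (_ * _).
  by apply: eq_bigr => u _; rewrite hornerXsubC.
rewrite hornerM horner_prod (bigD1 s) 1?eq_sym //= hornerXsubC subrr mul0r.
exact: mulr0.
Qed.

(* Lagrange interpolation: the numerators and the common denominator are      *)
(* symmetric in the roots.                                                    *)
Lemma resolvent_inversion : injective (fun s : 'S_n => theta s) ->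
  exists2 phi : 'I_n -> {poly L}, forall i, phi i \is a polyOver K
    & forall s i, (phi i).[theta s] = v (s i).
Proof.
move=> inj_theta.
have nz s : \prod_(u | u != s) (theta s - theta u) != 0.
  apply/prodf_neq0 => u us; rewrite subr_eq0; apply: contra us => /eqP.
  by move/inj_theta->.
have D s : (interp 1).[theta s] = \prod_(u | u != s) (theta s - theta u).
  by rewrite interpE msym1 rmorph1 mul1r.
(* The denominator vanishes at no value of the resolvent, so it has an inverse [w] modulo the
   auxiliary polynomial. *)
have cop : coprimep (auxiliary_poly v a) (interp 1).
  rewrite /auxiliary_poly coprimep_sym big_seq.
  apply: (big_ind (fun p => coprimep (interp 1) p)) => [|p q|s _].
  - exact: coprimep1.
  - by rewrite coprimepMr => -> ->.
  by rewrite coprimep_XsubC /root D nz.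
have [u [w [_ Kw uw1]]] :=
  polyOver_Bezout auxiliary_poly_known (interp_known 1) cop.
exists (fun i => w * interp 'X_i) => [i|s i]; first by rewrite rpredM.
have Psi0 : (auxiliary_poly v a).[theta s] = 0.
  by rewrite horner_prod (bigD1 s) //= hornerXsubC subrr mul0r.
have w1 : w.[theta s] * \prod_(u | u != s) (theta s - theta u) = 1.
  rewrite -D -hornerM -[LHS]add0r -(mulr0 u.[theta s]) -Psi0 -hornerM -hornerD.
  by rewrite uw1 hornerC.
rewrite hornerM interpE mulrCA w1 mulr1 /msym mmapX mmap1U.
exact: eval_knownX.
Qed.

End SymmetricFunctions.

(** * The group of a tuple *)

Notation rational_over K := (rational_function (fun x => is_true (x \in K))).

Lemma arrangeM (T : Type) n (s t : 'S_n) (x : 'I_n -> T) :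
  arrange s (arrange t x) = arrange (s * t)%g x.
Proof. by apply/funext => i; rewrite /arrange permM. Qed.

Lemma arrange1 (T : Type) n (x : 'I_n -> T) : arrange 1%g x = x.
Proof. by apply/funext => i; rewrite /arrange perm1. Qed.

Section RationalFunctions.
Variables (L : fieldType) (n : nat).
Implicit Types (f g : ('I_n -> L) -> L) (x : 'I_n -> L).

Lemma rational_function_sub (K K' : L -> Prop) f :
  (forall z, K z -> K' z) -> rational_function K f -> rational_function K' f.
Proof.
move=> sKK'; elim=> {f} [c /sKK' K'c|i|f g _ Kf _ Kg|f g _ Kf _ Kg|f _ Kf|f _
  Kf].
- exact: ratfun_const.
- exact: ratfun_arg.
- exact: ratfun_add.
- exact: ratfun_mul.
- exact: ratfun_opp.
- exact: ratfun_inv.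
Qed.

Lemma eq_rational_function K f g :
  f =1 g -> rational_function K f -> rational_function K g.
Proof. by move=> /funext->. Qed.

Variable K : divringClosed L.

Lemma rational_function_subr f g :
  rational_over K f -> rational_over K g -> rational_over K (fun x =>
    f x - g x).
Proof. by move=> Kf Kg; apply/(ratfun_add Kf)/ratfun_opp. Qed.

Lemma rational_function_sum (I : Type) (r : seq I) (P : pred I) F :
  (forall i, P i -> rational_over K (F i)) ->
  rational_over K (fun x => \sum_(i <- r | P i) F i x).
Proof.
move=> KF; elim: r => [|i r IHr].
  apply: (@eq_rational_function _ (fun=> 0)) => [x|]; first by rewrite big_nil.
  exact/ratfun_const/rpred0.
apply: (@eq_rational_function _ (fun x => (if P i then F i x else 0) +
  \sum_(j <- r | P j) F j x)) => [x|].
  by rewrite big_cons; case: ifP; rewrite ?add0r.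
apply: ratfun_add => //; case: (P i) (KF i) => [/(_ isT)|_] //;
  exact/ratfun_const/rpred0.
Qed.

Lemma rational_function_prod (I : Type) (r : seq I) (P : pred I) F :
  (forall i, P i -> rational_over K (F i)) ->
  rational_over K (fun x => \prod_(i <- r | P i) F i x).
Proof.
move=> KF; elim: r => [|i r IHr].
  apply: (@eq_rational_function _ (fun=> 1)) => [x|]; first by rewrite big_nil.
  exact/ratfun_const/rpred1.
apply: (@eq_rational_function _ (fun x => (if P i then F i x else 1) *
  \prod_(j <- r | P j) F j x)) => [x|].
  by rewrite big_cons; case: ifP; rewrite ?mul1r.
apply: ratfun_mul => //; case: (P i) (KF i) => [/(_ isT)|_] //;
  exact/ratfun_const/rpred1.
Qed.

Lemma rational_function_exp f k :
  rational_over K f -> rational_over K (fun x => f x ^+ k).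
Proof.
move=> Kf; apply: (@eq_rational_function _ (fun x => \prod_(i < k) f x))
  => [x|].
  by rewrite prodr_const card_ord.
exact: rational_function_prod.
Qed.

Lemma rational_function_subst m (h : 'I_m -> ('I_n -> L) -> L)
    (e : ('I_m -> L) -> L) :
  (forall i, rational_over K (h i)) -> rational_over K e ->
  rational_over K (fun x => e (fun i => h i x)).
Proof.
move=> Kh; elim=> {e} [c Kc|i|f g _ Kf _ Kg|f g _ Kf _ Kg|f _ Kf|f _ Kf] //.
- exact: ratfun_const.
- exact: ratfun_add.
- exact: ratfun_mul.
- exact: ratfun_opp.
- exact: ratfun_inv.
Qed.

Lemma rational_function_arrange f (s : 'S_n) :
  rational_over K f -> rational_over K (fun x => f (arrange s x)).
Proof. by apply: rational_function_subst => i; apply: ratfun_arg. Qed.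

Lemma rational_function_horner p f : p \is a polyOver K ->
  rational_over K f -> rational_over K (fun x => p.[f x]).
Proof.
move=> /polyOverP Kp Kf.
apply: (@eq_rational_function _ (fun x => \sum_(i < size p) p`_i * f x ^+ i)).
  by move=> x; rewrite horner_coef.
apply: rational_function_sum => i _; apply: ratfun_mul.
  exact: ratfun_const.
exact: rational_function_exp.
Qed.

Lemma rational_function_linear (a : 'I_n -> L) : (forall i, a i \in K) ->
  rational_over K (linear_function a).
Proof.
move=> Ka; apply: rational_function_sum => i _.
by apply: ratfun_mul; [apply: ratfun_const | apply: ratfun_arg].
Qed.

Lemma rational_function_coef_prod (I : Type) (r : seq I) (P : pred I) F k :
  (forall i, P i -> rational_over K (F i)) ->
  rational_over K (fun x => (\prod_(i <- r | P i) ('X - (F i x)%:P))`_k).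
Proof.
move=> KF; elim: r k => [|i r IHr] k.
  apply: (@eq_rational_function _ (fun=> (k == 0)%:R)) => [x|].
    by rewrite big_nil coef1.
  exact/ratfun_const/rpred_nat.
case Pi : (P i); last first.
  by apply: eq_rational_function (IHr k) => x; rewrite big_cons Pi.
apply: (@eq_rational_function _ (fun x =>
  (if (k == 0)%N then 0 else (\prod_(j <- r | P j) ('X - (F j x)%:P))`_k.-1)
  - F i x * (\prod_(j <- r | P j) ('X - (F j x)%:P))`_k)) => [x|].
  by rewrite big_cons Pi mulrBl coefB coefXM coefCM.
apply: rational_function_subr; last by apply: ratfun_mul; [apply: KF|].
by case: eqP => // _; apply/ratfun_const/rpred0.
Qed.

End RationalFunctions.

Section GaloisGroup.
Variables (L : fieldType) (K : divringClosed L) (n : nat) (v : 'I_n -> L).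
Implicit Types (f g : ('I_n -> L) -> L) (s t : 'S_n).

(** Equivalent to invariance of the known functions: a relation has the known value 0, and a known
    value [c] of [f] makes [f - c] a relation. In this form closure under composition is
    immediate. *)
Definition gal_set : {set 'S_n} :=
  [set s | `[< forall f, rational_over K f -> f v = 0 -> f (arrange s v)
    = 0 >]].

Lemma gal_setP s :
  reflect (forall f, rational_over K f -> f v = 0 -> f (arrange s v) = 0)
          (s \in gal_set).
Proof. by rewrite inE; apply: asboolP. Qed.

Lemma group_set_gal : group_set gal_set.
Proof.
apply/group_setP; split=> [|s t /gal_setP sG /gal_setP tG];
  apply/gal_setP => f Kf fv.
  by rewrite arrange1.
rewrite -arrangeM; apply: (tG (fun x => f (arrange s x))); last exact: sG.
exact: rational_function_arrange.
Qed.

Canonical gal : {group 'S_n} := Group group_set_gal.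

Lemma gal_eq s f g : s \in gal -> rational_over K f -> rational_over K g ->
  f v = g v -> f (arrange s v) = g (arrange s v).
Proof.
move=> /gal_setP sG Kf Kg fg; apply/eqP; rewrite -subr_eq0; apply/eqP.
by apply: (sG (fun x => f x - g x)); rewrite ?fg ?subrr //;
  apply: rational_function_subr.
Qed.

Lemma gal_known s f : s \in gal -> rational_over K f -> f v \in K ->
  f (arrange s v) = f v.
Proof.
by move=> sG Kf Kfv; apply: (@gal_eq s f (fun=> f v)) => //;
  apply: ratfun_const.
Qed.

Lemma galois_group_gal (G : {group 'S_n}) :
  galois_group (fun x => is_true (x \in K)) v G -> G = gal.
Proof.
move=> [invG maxG]; apply/val_inj/eqP; rewrite eqEsubset /=; apply/andP; split.
  apply/subsetP => s sG; apply/gal_setP => f Kf fv.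
  by rewrite (invG f) // fv rpred0.
by apply: (maxG gal) => f Kf Kfv s sG; apply: gal_known.
Qed.

Lemma gal_galois_group : galois_group (fun x => is_true (x \in K)) v gal.
Proof.
split=> [f Kf Kfv s sG|H invH]; first exact: gal_known.
apply/subsetP => s sH; apply/gal_setP => f Kf fv.
by rewrite (invH f) // fv rpred0.
Qed.

End GaloisGroup.

Lemma gal_sub (L : fieldType) (K K' : divringClosed L) n (v : 'I_n -> L) :
  {subset K <= K'} -> gal K' v \subset gal K v.
Proof.
move=> sKK'; apply/subsetP => s /gal_setP sG; apply/gal_setP => f Kf.
by apply: sG; apply: rational_function_sub Kf.
Qed.

Lemma monic_dvdp_prod_XsubC (L : fieldType) (I : finType) (z : I -> L)
  (p : {poly L}) :
  injective z -> p \is monic -> p %| \prod_i ('X - (z i)%:P) ->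
  p = \prod_(i | root p (z i)) ('X - (z i)%:P).
Proof.
move=> inj_z monp /dvdp_prod_XsubC[m].
rewrite -[\prod_(i <- mask _ _) _](big_map z xpredT (fun x => 'X - x%:P))
  => eqp_m.
have pE : p = \prod_(x <- map z (mask m (index_enum I))) ('X - x%:P).
  by apply/eqP; rewrite -eqp_monic ?monic_prod_XsubC.
rewrite {1}pE big_map -[RHS]big_filter.
apply: perm_big; apply: uniq_perm.
- by rewrite mask_uniq ?index_enum_uniq.
- by rewrite filter_uniq ?index_enum_uniq.
move=> i; rewrite mem_filter mem_index_enum andbT pE root_prod_XsubC.
by rewrite mem_map.
Qed.

Lemma root_prod_XsubC_fin (L : fieldType) (I : finType) (A : pred I)
  (z : I -> L) x :
  root (\prod_(i in A) ('X - (z i)%:P)) x = (x \in [seq z i | i in A]).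
Proof.
by rewrite -[\prod_(i in A) _](big_image _ _ z A (fun y => 'X - y%:P))
  root_prod_XsubC.
Qed.

Lemma size_prod_XsubC_fin (L : fieldType) (I : finType) (A : pred I)
  (z : I -> L) :
  size (\prod_(i in A) ('X - (z i)%:P)) = #|A|.+1.
Proof.
rewrite -[\prod_(i in A) _](big_image _ _ z A (fun y => 'X - y%:P)).
by rewrite size_prod_XsubC size_image.
Qed.

Section Resolvent.
Variables (L : fieldType) (K : divringClosed L) (n : nat) (v a : 'I_n -> L).
Hypothesis Kv : \prod_i ('X - (v i)%:P) \is a polyOver K.
Hypothesis Ka : forall i, a i \in K.
Local Notation theta s := (linear_function a (arrange s v)).
Hypothesis inj_theta : injective (fun s : 'S_n => theta s).

Let auxiliary_root : root (auxiliary_poly v a) (linear_function a v).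
Proof.
apply/rootP; rewrite horner_prod (bigD1 1%g) //= hornerXsubC arrange1.
by rewrite subrr mul0r.
Qed.

Let minpoly_exists : exists m, minimal_poly K (linear_function a v) m.
Proof.
apply: (@minimal_poly_exists _ _ _ (auxiliary_poly v a)).
- exact: auxiliary_poly_known.
- by apply/prodf_neq0 => s _; rewrite polyXsubC_eq0.
exact: auxiliary_root.
Qed.

(** A single [h] serves all conjugates. For an inverse, either [m] divides the polynomial, which
    then vanishes at every conjugate and has inverse 0 by convention, or the polynomial is
    invertible modulo [m]. *)
Lemma rational_function_resolvent m f :
  minimal_poly K (linear_function a v) m -> rational_over K f ->
  exists2 h, h \is a polyOver K &
    forall s, root m (theta s) -> f (arrange s v) = h.[theta s].
Proof.
move=> mP; have [Km _ m1 minm] := mP.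
elim=> {f} [c Kc|i|f g _ [h Kh fE] _ [k Kk gE]|f g _ [h Kh fE] _ [k Kk gE]
           |f _ [h Kh fE]|f _ [h Kh fE]].
- by exists c%:P => [|s _]; rewrite ?polyOverC ?hornerC.
- have [phi Kphi phiE] := resolvent_inversion Kv Ka inj_theta.
  by exists (phi i).
- by exists (h + k) => [|s ms]; rewrite ?rpredD // hornerD fE ?gE.
- by exists (h * k) => [|s ms]; rewrite ?rpredM // hornerM fE ?gE.
- by exists (- h) => [|s ms]; rewrite ?rpredN // hornerN fE.
have [h0|h0] := boolP (root h (linear_function a v)).
  exists 0 => [|s ms]; rewrite ?rpred0 // horner0 fE //.
  have /dvdpP[q ->] := minm h Kh h0.
  by rewrite hornerM (eqP ms) mulr0 invr0.
have [u Ku uE] := minimal_poly_inv mP Kh h0.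
by exists u => // s ms; rewrite uE // fE.
Qed.

Lemma minimal_poly_gal m s : minimal_poly K (linear_function a v) m ->
  root m (theta s) = (s \in gal K v).
Proof.
move=> mP; have [Km _ m1 minm] := mP; apply/idP/idP => [ms|sG].
  apply/gal_setP => f /(rational_function_resolvent mP)[h Kh fE] f0.
  rewrite fE //; have := fE 1%g; rewrite arrange1 f0 => /(_ m1)/esym/eqP.
  by move=> /(minm h Kh)/dvdpP[q ->]; rewrite hornerM (eqP ms) mulr0.
apply/eqP; apply: (gal_setP _ _ _ sG (fun x => m.[linear_function a x])).
  by apply: rational_function_horner => //; apply: rational_function_linear.
exact/eqP.
Qed.

Lemma minimal_poly_resolvent :
  minimal_poly K (linear_function a v)
    (\prod_(s in gal K v) ('X - (theta s)%:P)).
Proof.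
have [m mP] := minpoly_exists;
  suff <- : m = \prod_(s in gal K v) ('X - (theta s)%:P) by [].
have [Km monm m1 minm] := mP.
have /(monic_dvdp_prod_XsubC inj_theta monm) {1}-> : m %| auxiliary_poly v a.
  apply: minm; first exact: auxiliary_poly_known.
  exact: auxiliary_root.
by apply: eq_bigl => s; rewrite minimal_poly_gal.
Qed.

(** Reduced modulo [m], the polynomial that represents [f] takes the value [f v] at more points than
    its degree. It is constant, and its constant coefficient lies in [K]. *)
Lemma gal_invariant_resolvent f : rational_over K f ->
  (forall s, s \in gal K v -> f (arrange s v) = f v) -> f v \in K.
Proof.
move=> Kf inv_f; pose m := \prod_(s in gal K v) ('X - (theta s)%:P).
have mP : minimal_poly K (linear_function a v) m := minimal_poly_resolvent.
have [Km monm m1 minm] := mP.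
have [h Kh fE] := rational_function_resolvent mP Kf.
pose k := h %% m - (f v)%:P.
have sm : size m = #|gal K v|.+1.
  by rewrite size_prod_XsubC_fin.
have k0 : k = 0.
  apply: (@roots_geq_poly_eq0 _ _ (image (fun s => theta s) (gal K v))).
  - apply/allP => _ /imageP[s sG ->]; rewrite /root /k !hornerE.
    have ms : root m (theta s) by rewrite minimal_poly_gal.
    by rewrite -(inv_f s sG) fE // {2}(divp_eq h m) hornerD hornerM (eqP ms)
               mulr0 add0r subrr.
  - by rewrite map_inj_uniq ?enum_uniq.
  rewrite size_image -ltnS -sm (leq_ltn_trans (size_polyD _ _)) //.
  rewrite gtn_max size_polyN ltn_modp monic_neq0 //=.
  by rewrite (leq_ltn_trans (size_polyC_leq1 _)) // sm ltnS cardG_gt0.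
have -> : f v = (h %% m)`_0.
  by have /eqP := k0; rewrite subr_eq0 => /eqP->; rewrite coefC.
exact/polyOverP/polyOver_modp.
Qed.

End Resolvent.

Section ResolventExists.
Variables (L : fieldType) (n : nat) (v : 'I_n -> L).
Hypothesis char0 : [pchar L] =i pred0.

Lemma natr_inj_char0 : injective (fun k : nat => k%:R : L).
Proof.
suff H i j : (i <= j)%N -> i%:R = j%:R :> L -> i = j.
  by move=> i j ij; case: (leqP i j) => [/H|/ltnW/H/(_ (esym ij))/esym]; auto.
move=> le_ij /eqP; rewrite eq_sym -subr_eq0 -natrB //.
rewrite (GRing.pcharf0P L).1 // subn_eq0 => le_ji.
by apply/eqP; rewrite eqn_leq le_ij.
Qed.

(* The constants are the powers of a natural number that avoids the zeros of  *)
(* finitely many polynomials.                                                 *)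
Lemma resolvent_exists : injective v ->
  exists c : nat, injective (fun s : 'S_n =>
    linear_function (fun i : 'I_n => c%:R ^+ i) (arrange s v)).
Proof.
move=> inj_v; pose D (u : 'S_n * 'S_n) : {poly L} :=
  \poly_(k < n) (if insub k is Some i then v (u.1 i) - v (u.2 i) else 0).
pose p := \prod_(u | u.1 != u.2) D u.
have DE u (c : L) : (D u).[c] = linear_function (fun i : 'I_n => c ^+ i)
  (arrange u.1 v)
    - linear_function (fun i : 'I_n => c ^+ i) (arrange u.2 v).
  rewrite horner_poly -sumrB; apply: eq_bigr => i _.
  by rewrite valK /arrange -mulrBr mulrC.
have nzp : p != 0.
  apply/prodf_neq0 => -[s t] /=; apply: contraNneq => D0; apply/eqP/permP => i.
  apply/inj_v/eqP; rewrite -subr_eq0.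
  by have := congr1 (fun q : {poly L} => q`_i) D0;
    rewrite coef_poly ltn_ord valK coef0 => ->.
have [c pc] : exists c : nat, ~~ root p c%:R.
  pose rs := [seq (c%:R : L) | c <- iota 0 (size p)].
  have : ~~ all (root p) rs.
    apply/negP => rp; have := max_poly_roots nzp rp.
    by rewrite (map_inj_uniq natr_inj_char0)
      iota_uniq size_map size_iota ltnn => /(_ isT).
  by case/allPn => _ /mapP[c _ ->] pc; exists c.
exists c => s t /eqP; rewrite -subr_eq0; apply: contraTeq => st.
rewrite -(DE (s, t)); apply: contra pc => Dst.
by rewrite /root horner_prod (bigD1 (s, t)) //= (eqP Dst) mul0r.
Qed.

Variable K : divringClosed L.
Hypothesis Kv : \prod_i ('X - (v i)%:P) \is a polyOver K.
Hypothesis inj_v : injective v.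

Lemma known_resolvent_exists : exists2 a : 'I_n -> L, forall i, a i \in K
  & injective (fun s : 'S_n => linear_function a (arrange s v)).
Proof.
have [c inj_c] := resolvent_exists inj_v.
by exists (fun i : 'I_n => c%:R ^+ i) => // i; rewrite rpredX ?rpred_nat.
Qed.

Lemma gal_invariant_known f : rational_over K f ->
  (forall s, s \in gal K v -> f (arrange s v) = f v) -> f v \in K.
Proof.
have [a Ka inj_a] := known_resolvent_exists.
exact: gal_invariant_resolvent Kv Ka inj_a f.
Qed.

End ResolventExists.

(** * Comparing the groups over two fields *)

Section ChangeOfField.
Variables (L : fieldType) (char0 : [pchar L] =i pred0).
Variables (K K' : divringClosed L) (sKK' : {subset K <= K'}).

Definition rational_image n (v : 'I_n -> L) : {pred L} :=
  fun x => `[< exists2 f, rational_over K f & f v = x >].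

Lemma rational_imageP n (v : 'I_n -> L) x :
  reflect (exists2 f, rational_over K f & f v = x) (x \in rational_image v).
Proof. exact: asboolP. Qed.

Lemma rational_image_id n (v : 'I_n -> L) i : v i \in rational_image v.
Proof.
by apply/rational_imageP; exists (fun x => x i) => //; apply: ratfun_arg.
Qed.

Lemma rational_image_sub n m (v : 'I_n -> L) (w : 'I_m -> L) :
  (forall i, v i \in rational_image w) ->
  {subset rational_image v <= rational_image w}.
Proof.
move=> vw _ /rational_imageP[f Kf <-]; apply/rational_imageP.
elim: Kf => {f} [c Kc|i|f g _ [h Kh <-] _ [k Kk <-]|f g _ [h Kh <-] _ [k Kk <-]
                |f _ [h Kh <-]|f _ [h Kh <-]].
- by exists (fun=> c) => //; apply: ratfun_const.
- exact/rational_imageP.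
- by exists (fun x => h x + k x) => //; apply: ratfun_add.
- by exists (fun x => h x * k x) => //; apply: ratfun_mul.
- by exists (fun x => - h x) => //; apply: ratfun_opp.
- by exists (fun x => (h x)^-1) => //; apply: ratfun_inv.
Qed.

Variables (n : nat) (v : 'I_n -> L).
Hypothesis Kv : \prod_i ('X - (v i)%:P) \is a polyOver K.
Hypothesis inj_v : injective v.

(** Conversely, the minimal polynomial over [K'] of a resolvent value has coefficients in [K(v)] and
    in [K'], hence in [K]. So every element of [gal K v] permutes its roots, which puts it in
    [gal K' v]. *)
Lemma gal_eqP :
  gal K v = gal K' v :> {set _} <->
  (forall x, x \in rational_image v -> x \in K' -> x \in K).
Proof.
have K'v : \prod_i ('X - (v i)%:P) \is a polyOver K' by apply: polyOverS Kv.
split=> [eq_gal _ /rational_imageP[f Kf <-] K'f|H].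
  apply: (gal_invariant_known char0 Kv inj_v Kf) => s; rewrite /= eq_gal => sG.
  by apply: gal_known sG _ K'f; apply: rational_function_sub Kf.
apply/eqP; rewrite eqEsubset (gal_sub v sKK') andbT; apply/subsetP => s sG.
have [a Ka inj_a] := known_resolvent_exists char0 K inj_v.
have K'a i : a i \in K' by apply: sKK'.
have mP := minimal_poly_resolvent K'v K'a inj_a.
rewrite -(minimal_poly_gal K'v K'a inj_a s mP).
have [K'm _ m1 _] := mP.
set m := \prod_(t in _) _ in m1 K'm *.
have Km : m \is a polyOver K.
  apply/polyOverP => k; apply: H; last exact/polyOverP.
  apply/rational_imageP; exists (fun x =>
    (\prod_(t in gal K' v) ('X - (linear_function a (arrange t x))%:P))`_k)
      => //.
  apply: rational_function_coef_prod => t _.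
  by apply: rational_function_arrange; apply: rational_function_linear.
apply/eqP; apply: (gal_setP _ _ _ sG (fun x => m.[linear_function a x])).
  by apply: rational_function_horner => //; apply: rational_function_linear.
exact/eqP.
Qed.

End ChangeOfField.

(** * Irreducible factors of the auxiliary polynomial *)

Section AuxiliaryFactors.
Variables (L : closedFieldType) (K : divringClosed L) (n : nat)
  (v a : 'I_n -> L).
Hypothesis Kv : \prod_i ('X - (v i)%:P) \is a polyOver K.
Hypothesis Ka : forall i, a i \in K.
Local Notation theta s := (linear_function a (arrange s v)).
Hypothesis inj_theta : injective (fun s : 'S_n => theta s).

Lemma auxiliary_factor_root (q : {poly L}) : (1 < size q)%N ->
  q %| auxiliary_poly v a -> exists s : 'S_n, root q (theta s).
Proof.
move=> sq /dvdpP[q' qE]; have /closed_rootP[x qx] : size q != 1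
  by rewrite gtn_eqF.
have : root (auxiliary_poly v a) x by rewrite qE rootM qx orbT.
by rewrite /auxiliary_poly root_prod_XsubC_fin => /imageP[s _ xE]; exists s;
  rewrite -xE.
Qed.

Let orbit_inj s : injective (fun u : 'S_n => theta (s * u)%g).
Proof. by move=> t u /inj_theta/mulgI. Qed.

Lemma size_factor_gal (q : {poly L}) s : q \is a polyOver K -> q != 0 ->
  root q (theta s) -> \prod_(u in gal K v) ('X - (theta (s * u)%g)%:P) %| q.
Proof.
move=> Kq nzq qs; rewrite -[\prod_(u in _) _]
  (big_image _ _ (fun u => theta (s * u)%g) _ (fun x => 'X - x%:P)).
apply: uniq_roots_dvdp; last by rewrite uniq_rootsE map_inj_uniq ?enum_uniq.
apply/allP => _ /imageP[u uG ->]; rewrite /root -arrangeM; apply/eqP.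
apply: (gal_setP _ _ _ uG (fun x => q.[linear_function a (arrange s x)])).
  apply: rational_function_horner => //; apply: rational_function_arrange.
  exact: rational_function_linear.
exact/eqP.
Qed.

(** The values of the resolvent fall into orbits [theta (s * u)], with [u] in the group, all of the
    size of the group. A polynomial over [K] that vanishes at one value vanishes on its orbit, and
    the product over an orbit has invariant, hence known, coefficients. *)
Lemma irreducible_auxiliary_factor (q : {poly L}) : [pchar L] =i pred0 ->
  q \is a polyOver K -> (1 < size q)%N -> q %| auxiliary_poly v a ->
  irreducible_over (fun x => is_true (x \in K)) q <-> size q = #|gal K v|.+1.
Proof.
move=> char0 Kq sq qPsi.
have nzq : q != 0 by rewrite -size_poly_gt0 (ltn_trans _ sq).
have inj_v : injective v.
  move=> i j vij; apply/eqP; apply: contraTT isT => nij.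
  suff /inj_theta/permP/(_ i) : theta (tperm i j) = theta 1%g.
    by rewrite tpermL perm1 => ji; rewrite ji eqxx in nij.
  apply: eq_bigr => k _; congr (_ * _); rewrite arrange1 /arrange.
  by case: tpermP => [->|->|].
split=> [[_ _ irr]|sqE].
  have [s qs] := auxiliary_factor_root sq qPsi.
  pose g := \prod_(u in gal K v) ('X - (theta (s * u)%g)%:P).
  have gq : g %| q by apply: size_factor_gal.
  have sg : size g = #|gal K v|.+1 by rewrite /g size_prod_XsubC_fin.
  have nzg : g != 0 by rewrite -size_poly_gt0 sg.
  have Kg : g \is a polyOver K.
    apply/polyOverP => k.
    pose f x := (\prod_(u in gal K v)
      ('X - (linear_function a (arrange (s * u)%g x))%:P))`_k.
    have Kf : rational_over K f.
      apply: rational_function_coef_prod => u _;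
        apply: rational_function_arrange.
      exact: rational_function_linear.
    apply: (gal_invariant_known char0 Kv inj_v Kf) => t tG.
    rewrite /f [in RHS](reindex_inj (mulIg t)) /=; congr (nth 0 (polyseq _) k).
    by apply: eq_big => u; [rewrite groupMr | rewrite arrangeM mulgA].
  apply/eqP; rewrite -sg eqn_leq (dvdp_leq _ gq) // andbT leqNgt.
  apply/negP => ltgq; apply: irr; exists (q %/ g), g; split=> //.
  - by apply/polyOverP/polyOver_divp.
  - exact/polyOverP.
  - rewrite size_divp // sg ltn_subrL cardG_gt0 /=.
    by rewrite (ltn_trans _ sq).
  - by rewrite divpK.
split=> [||[f [g [Kf Kg sf sg qE]]]] //; first exact/polyOverP.
have [nzf nzg] : f != 0 /\ g != 0.
  by apply/andP; rewrite -negb_or -mulf_eq0 -qE.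
have sf1 : (1 < size f)%N.
  rewrite ltn_neqAle size_poly_gt0 nzf andbT; apply/negP => /eqP s1.
  by move: sg; rewrite qE size_mul // -s1 ltnn.
have [s fs] : exists s : 'S_n, root f (theta s).
  by apply: auxiliary_factor_root => //; apply: dvdp_trans qPsi;
    rewrite qE dvdp_mulr.
have /(dvdp_leq nzf) : \prod_(u in gal K v) ('X - (theta (s * u)%g)%:P) %| f.
  by apply: size_factor_gal => //; apply/polyOverP.
by rewrite size_prod_XsubC_fin -sqE leqNgt sf.
Qed.

End AuxiliaryFactors.

(** * Adjunction of a root of prime order *)

Lemma rpred_coprime_exp (L : fieldType) (K : divringClosed L) (y : L)
  (i j : nat) :
  (0 < i)%N -> y ^+ i \in K -> y ^+ j \in K -> coprime i j -> y \in K.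
Proof.
have [->|nzy] := eqVneq y 0; first by rewrite rpred0.
move=> i_gt0 Kyi Kyj /(coprimeP _ i_gt0)[[k l] /= kl].
have kE : (k * i = l * j + 1)%N.
  by rewrite -kl subnKC // ltnW // -subn_gt0 kl.
have -> : y = (y ^+ i) ^+ k / (y ^+ j) ^+ l.
  by rewrite -!exprM [(i * k)%N]mulnC kE exprD expr1 [(j * l)%N]mulnC mulrAC
    divff ?mul1r ?expf_neq0.
by apply: rpred_div; apply: rpredX.
Qed.

Lemma primitive_root_neq0 (L : fieldType) p (z : L)
  : p.-primitive_root z -> z != 0.
Proof.
move=> z_prim; apply: contra_eqN (prim_expr_order z_prim) => /eqP->.
by rewrite expr0n gtn_eqF ?(prim_order_gt0 z_prim) // eq_sym oner_eq0.
Qed.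

Lemma prime_primitive_root (L : fieldType) p (z : L) :
  prime p -> z ^+ p = 1 -> z != 1 -> p.-primitive_root z.
Proof.
move=> p_pr zp nz1; have [m mz mp] := prim_order_exists (prime_gt0 p_pr) zp.
case/primeP: p_pr => _ /(_ m mp)/orP[/eqP m1|/eqP<- //].
by move: nz1; rewrite -(prim_expr_order mz) m1 expr1 eqxx.
Qed.

Lemma prime_coprime_lt p i : prime p -> (0 < i)%N -> (i < p)%N -> coprime i p.
Proof.
move=> p_pr i_gt0 lt_ip; rewrite coprime_sym prime_coprime //.
by apply: contraL lt_ip => /(dvdn_leq i_gt0); rewrite -leqNgt.
Qed.

Lemma sum_primitive_root (L : fieldType) N (z : L) k : N.-primitive_root z ->
  \sum_(j < N) z ^+ (j * k) = if (N %| k)%N then N%:R else 0.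
Proof.
move=> z_prim; under eq_bigr => j _ do rewrite mulnC exprM.
case: ifP => [/dvdnP[m ->]|Nk].
  under eq_bigr => j _ do rewrite mulnC exprM (prim_expr_order z_prim) !expr1n.
  by rewrite sumr_const card_ord.
have nz1 : z ^+ k - 1 != 0.
  rewrite subr_eq0; apply/eqP => zk.
  by rewrite (prim_order_dvd z_prim) zk eqxx in Nk.
apply: (mulfI nz1); rewrite mulr0 -(subrX1 (z ^+ k) N) -exprM mulnC exprM.
by rewrite (prim_expr_order z_prim) expr1n subrr.
Qed.

Section RadicalConjugates.
Variables (L : fieldType) (K : divringClosed L) (p : nat) (z y : L).
Hypotheses (p_pr : prime p) (z_prim : p.-primitive_root z).

Let p_gt0 : (0 < p)%N := prime_gt0 p_pr.

Lemma factor_Xn_sub_exp : y != 0 ->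
  'X^p - (y ^+ p)%:P = \prod_(j < p) ('X - (z ^+ j * y)%:P).
Proof.
move=> nzy.
have -> : \prod_(j < p) ('X - (z ^+ j * y)%:P) =
    \prod_(x <- [seq z ^+ val j * y | j : 'I_p]) ('X - x%:P)
      by rewrite big_image.
rewrite [LHS](@all_roots_prod_XsubC _ _ [seq z ^+ val j * y | j : 'I_p]).
- by rewrite (monicP _) ?scale1r // monicXnsubC.
- by rewrite size_XnsubC // size_image card_ord.
- apply/allP => _ /imageP[j _ ->];
  rewrite /root !hornerE exprMn -exprM mulnC exprM.
  by rewrite (prim_expr_order z_prim) expr1n mul1r subrr.
rewrite uniq_rootsE map_inj_uniq ?enum_uniq // => i j /(mulIf nzy)/eqP.
by rewrite (eq_prim_root_expr z_prim) !modn_small ?ltn_ord // => /eqP/val_inj.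
Qed.

Hypotheses (Kz : z \in K) (Kyp : y ^+ p \in K) (Ky : y \notin K).

Let nzy : y != 0. Proof. by apply: contraNneq Ky => ->; rewrite rpred0. Qed.

(** The minimal polynomial of [y] has some of the [z ^+ i * y] as roots, say [#|J|] of them, and its
    constant term puts [y ^+ #|J|] in [K]. If [#|J| < p], this exponent is coprime to [p] and [y]
    itself would be in [K]. *)
Lemma root_conjugate (g : {poly L}) j :
  g \is a polyOver K -> root g y -> root g (z ^+ j * y).
Proof.
move=> Kg gy.
have KX : 'X^p - (y ^+ p)%:P \is a polyOver K.
  by rewrite rpredB ?polyOverXn ?polyOverC.
have yX : root ('X^p - (y ^+ p)%:P) y by rewrite /root !hornerE subrr.
have nzX : 'X^p - (y ^+ p)%:P != 0 by rewrite monic_neq0 ?monicXnsubC.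
have [m [Km monm my minm]] := minimal_poly_exists KX nzX yX.
have inj_zy : injective (fun i : 'I_p => z ^+ i * y).
  move=> i k /(mulIf nzy)/eqP.
  by rewrite (eq_prim_root_expr z_prim) !modn_small ?ltn_ord // => /eqP/val_inj.
have mE : m = \prod_(i < p | root m (z ^+ i * y)) ('X - (z ^+ i * y)%:P).
  by apply: monic_dvdp_prod_XsubC => //; rewrite -factor_Xn_sub_exp // minm.
pose J := [pred i : 'I_p | root m (z ^+ i * y)].
have KyJ : y ^+ #|J| \in K.
  have : m.[0] \in K by rewrite rpred_horner ?rpred0.
  rewrite mE horner_prod (eq_bigr (fun i : 'I_p => - z ^+ i * y)); last first.
    by move=> i _; rewrite !hornerE mulNr.
  rewrite big_split /= prodr_const => KJ.
  have nzz : \prod_(i < p | root m (z ^+ i * y)) - z ^+ i != 0.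
    by apply/prodf_neq0 => i _;
      rewrite oppr_eq0 expf_neq0 // (primitive_root_neq0 z_prim).
  rewrite -(mulKf nzz (y ^+ _)) rpredM // rpredV rpred_prod // => i _.
  by rewrite rpredN rpredX.
have J_gt0 : (0 < #|J|)%N.
  by apply/card_gt0P; exists (Ordinal p_gt0); rewrite inE /= mul1r.
have Jfull : #|J| = p.
  apply/eqP; rewrite eqn_leq; have /= leJ := max_card J;
    rewrite card_ord in leJ.
  rewrite leJ leqNgt /=; apply: contra Ky => ltJ.
  exact: rpred_coprime_exp J_gt0 KyJ Kyp (prime_coprime_lt p_pr J_gt0 ltJ).
have Jall i : i \in J.
  have /subset_cardP : #|J| = #|'I_p| by rewrite card_ord.
  by move=> /(_ (subset_predT _)) ->.
have jE : z ^+ j = z ^+ (Ordinal (ltn_pmod j p_gt0))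
  by rewrite /= (prim_expr_mod z_prim).
have /dvdpP[q ->] := minm g Kg gy.
by rewrite rootM jE [root m _](Jall _) orbT.
Qed.

Lemma irreducible_Xn_sub_exp :
  irreducible_over (fun x => is_true (x \in K)) ('X^p - (y ^+ p)%:P).
Proof.
split=> [||[f [g [/polyOverP Kf /polyOverP Kg sf sg fg]]]].
- by apply/polyOverP; rewrite rpredB ?polyOverXn ?polyOverC.
- by rewrite size_XnsubC // ltnS.
have big_conj (h : {poly L})
  : h \is a polyOver K -> h != 0 -> root h y -> (p < size h)%N.
  move=> Kh nzh hy; have := @max_poly_roots _ h [seq z ^+ val j * y | j : 'I_p]
    nzh.
  rewrite size_image card_ord; apply.
    by apply/allP => _ /imageP[j _ ->]; apply: root_conjugate.
  rewrite map_inj_uniq ?enum_uniq // => i j /(mulIf nzy)/eqP.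
  by rewrite (eq_prim_root_expr z_prim) !modn_small ?ltn_ord // => /eqP/val_inj.
have nzX : 'X^p - (y ^+ p)%:P != 0 by rewrite monic_neq0 ?monicXnsubC.
have [nzf nzg] : f != 0 /\ g != 0.
  by apply/andP; rewrite -negb_or -mulf_eq0 -fg.
have : root (f * g) y by rewrite -fg /root !hornerE subrr.
rewrite size_XnsubC // !ltnS in sf sg.
by rewrite rootM => /orP[/(big_conj f Kf nzf)|/(big_conj g Kg nzg)];
   rewrite ltnNge ?sf ?sg.
Qed.

End RadicalConjugates.

Lemma rational_image_divring_closed (L : fieldType) (K : divringClosed L) n
  (v : 'I_n -> L) : divring_closed (rational_image K v).
Proof.
split=> [|_ _ /rational_imageP[f Kf <-] /rational_imageP[g Kg <-]
         |_ _ /rational_imageP[f Kf <-] /rational_imageP[g Kg <-]];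
  apply/rational_imageP.
- by exists (fun=> 1) => //; apply/ratfun_const/rpred1.
- by exists (fun x => f x - g x) => //; apply: rational_function_subr.
- by exists (fun x => f x / g x) => //; apply/(ratfun_mul Kf)/ratfun_inv.
Qed.

HB.instance Definition _ (L : fieldType) (K : divringClosed L)
  n (v : 'I_n -> L) :=
  GRing.isDivringClosed.Build L (rational_image K v)
    (rational_image_divring_closed K v).

Lemma sub_rational_image (L : fieldType) (K : divringClosed L)
  n (v : 'I_n -> L) :
  {subset K <= rational_image K v}.
Proof.
by move=> c Kc; apply/rational_imageP; exists (fun=> c) => //;
  apply: ratfun_const.
Qed.

(** * The effect on the group of adjoining a root of prime order *)

Section KummerStep.
Variables (L : fieldType) (char0 : [pchar L] =i pred0).
Variables (K K' : divringClosed L) (sKK' : {subset K <= K'}).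
Variables (p : nat) (z y : L).
Hypotheses (p_pr : prime p) (z_prim : p.-primitive_root z).
Hypotheses (Kz : z \in K) (Kyp : y ^+ p \in K) (K'y : y \in K').
Hypothesis K'gen : forall x, x \in K' ->
  exists2 C, C \is a polyOver K & x = C.[y].
Variables (n : nat) (v : 'I_n -> L).
Hypotheses (Kv : \prod_i ('X - (v i)%:P) \is a polyOver K)
  (inj_v : injective v).
Hypothesis neq_gal : gal K v <> gal K' v :> {set _}.

Let V : divringClosed L := rational_image K v.
Let p_gt0 : (0 < p)%N := prime_gt0 p_pr.

Let Ky : y \notin K.
Proof.
apply/negP => Ky; apply: neq_gal; apply/(gal_eqP char0 sKK' Kv inj_v) => x _.
by move=> /K'gen[C KC ->]; rewrite rpred_horner.
Qed.

Let nzy : y != 0. Proof. by apply: contraNneq Ky => ->; rewrite rpred0. Qed.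

Lemma polyOver_conjugates f : rational_over K f ->
  \prod_(s in gal K v) ('X - (f (arrange s v))%:P) \is a polyOver K.
Proof.
move=> Kf; apply/polyOverP => k.
pose F x := (\prod_(s in gal K v) ('X - (f (arrange s x))%:P))`_k.
have KF : rational_over K F.
  by apply: rational_function_coef_prod => s _;
    apply: rational_function_arrange.
apply: (gal_invariant_known char0 Kv inj_v KF) => t tG.
rewrite /F [in RHS](reindex_inj (mulIg t)) /=; congr (nth 0 (polyseq _) k).
by apply: eq_big => u; [rewrite groupMr | rewrite arrangeM].
Qed.

(** [C.[y]] is a root of a polynomial [M] over [K] whose roots are all functions of [v]; as
    [M \Po C] vanishes at [y], it vanishes at the conjugate [z ^+ j * y]. *)
Let conjugate_in (C : {poly L}) j : C \is a polyOver K -> C.[y] \in V ->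
  C.[z ^+ j * y] \in V.
Proof.
move=> KC /rational_imageP[f Kf fv].
pose M := \prod_(s in gal K v) ('X - (f (arrange s v))%:P).
have KMC : M \Po C \is a polyOver K
  by rewrite polyOver_comp ?polyOver_conjugates.
have MCy : root (M \Po C) y.
  rewrite /root horner_comp horner_prod (bigD1 1%g) ?group1 //=.
  by rewrite arrange1 hornerXsubC fv subrr mul0r.
have := root_conjugate p_pr z_prim Kz Kyp Ky j KMC MCy.
rewrite /root horner_comp => /eqP/rootP.
rewrite root_prod_XsubC_fin => /imageP[s _ ->].
by apply/rational_imageP; exists (fun x => f (arrange s x)) => //;
   apply: rational_function_arrange.
Qed.

(* A function of v that becomes known by the adjunction of y is a polynomial  *)
(* in y; its conjugates are functions of v as well, so the Lagrange           *)
(* resolvents of these, which are its monomials in y, are functions of v.     *)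
Lemma radical_in_rational_image : y \in V.
Proof.
have [x [Vx K'x nKx]] : exists x, [/\ x \in V, x \in K' & x \notin K].
  apply: contrapT => H; apply: neq_gal; apply/(gal_eqP char0 sKK' Kv inj_v).
  by move=> x Vx K'x; apply: contrapT => /negP nKx; apply: H; exists x.
have [C KC xC] := K'gen K'x.
have KX : 'X^p - (y ^+ p)%:P \is a polyOver K.
  by rewrite rpredB ?polyOverXn ?polyOverC.
pose D := C %% ('X^p - (y ^+ p)%:P).
have KD : D \is a polyOver K by apply: polyOver_modp.
have Dy : D.[y] = x.
  rewrite xC [in RHS](divp_eq C ('X^p - (y ^+ p)%:P)) hornerD hornerM.
  by rewrite [X in _ * X]/= !hornerE subrr mulr0 add0r.
have sD : (size D <= p)%N.
  by rewrite -ltnS -(size_XnsubC (y ^+ p) p_gt0)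
    ltn_modp monic_neq0 ?monicXnsubC.
have DE w : D.[w] = \sum_(k < p) D`_k * w ^+ k by apply: horner_coef_wide.
have nzp : p%:R != 0 :> L by rewrite (GRing.pcharf0P L).1 // -lt0n.
have Vmon (i : 'I_p) : D`_i * y ^+ i \in V.
  (* Fourier inversion over the conjugates; [p - i] stands for the exponent [- i], since [z] has
     order [p]. *)
  have -> : D`_i * y ^+ i =
      p%:R^-1 * \sum_(j < p) z ^+ (j * (p - i)) * D.[z ^+ j * y].
    have ZE (j k : nat) : z ^+ (j * (p - i)) * (D`_k * (z ^+ j * y) ^+ k) =
        z ^+ (j * (p - i + k)) * (D`_k * y ^+ k).
      by rewrite mulnDr exprD exprMn -exprM -!mulrA; congr (_ * _);
        rewrite mulrCA.
    under eq_bigr => j _ do rewrite DE mulr_sumr.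
    under eq_bigr => j _ do under eq_bigr => k _ do rewrite ZE.
    rewrite exchange_big (bigD1 i) //= [X in _ + X]big1 ?addr0 => [|k ki].
      rewrite (eq_bigr (fun=> D`_i * y ^+ i)) => [|j _].
        by rewrite sumr_const card_ord -[_ * _ *+ p]mulr_natl mulKf.
      rewrite subnK 1?ltnW //.
      by rewrite mulnC exprM (prim_expr_order z_prim) expr1n mul1r.
    rewrite -mulr_suml (sum_primitive_root _ z_prim) ifF ?mul0r //.
    apply/negbTE; apply: contra ki => dv; apply/eqP/val_inj => /=.
    rewrite -(modn_small (ltn_ord k)) -[in RHS](modn_small (ltn_ord i)).
    apply/eqP; rewrite -(eqn_modDl (p - i)) subnK 1?ltnW // modnn.
    exact: dv.
  rewrite rpredM ?rpredV ?rpred_nat // rpred_sum // => j _.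
  rewrite rpredM ?conjugate_in ?Dy //.
  by rewrite rpredX // sub_rational_image.
have [i nKi] : exists i : 'I_p, D`_i * y ^+ i \notin K.
  apply: contrapT => H; move/negP: nKx; apply;
    rewrite -Dy DE rpred_sum // => i _.
  by apply: contrapT => /negP nKi; apply: H; exists i.
have KDi : D`_i \in K by apply/polyOverP.
have nzD : D`_i != 0 by apply: contraNneq nKi => ->; rewrite mul0r rpred0.
have i_gt0 : (0 < i)%N.
  by rewrite lt0n; apply: contraNneq nKi => i0; rewrite [X in y ^+ X]i0 mulr1.
apply: (@rpred_coprime_exp _ V y i p) => //.
- rewrite -(mulKf nzD (y ^+ i)) rpredM //.
  by rewrite rpredV sub_rational_image.
- exact: sub_rational_image.
exact: prime_coprime_lt.
Qed.

(** Write [y = g v]. The ratio [chi s] is a [p]-th root of unity, hence in [K], which makes [chi]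
    multiplicative on [gal K v]. Its kernel is [gal K' v], and as the groups differ it takes a value
    of order [p]. *)
Lemma kummer_step :
  [/\ (gal K' v <| gal K v)%g, cyclic (gal K v / gal K' v)%g
    & #|(gal K v / gal K' v)%g| = p].
Proof.
have /rational_imageP[g Kg gv] := radical_in_rational_image.
pose chi s := g (arrange s v) / y.
have gE s : g (arrange s v) = chi s * y by rewrite mulfVK.
have chiXp s : s \in gal K v -> chi s ^+ p = 1.
  move=> sG; rewrite expr_div_n.
  have -> : g (arrange s v) ^+ p = y ^+ p; last by rewrite divff ?expf_neq0.
  rewrite -gv; apply: (@gal_known _ K _ v s (fun x => g x ^+ p)) => //.
    exact: rational_function_exp.
  by rewrite gv.
have chi1 : chi 1%g = 1 by rewrite /chi arrange1 gv divff.
have Kchi s : s \in gal K v -> chi s \in K.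
  by move=> /chiXp/(prim_rootP z_prim)[i ->]; rewrite rpredX.
have chiM s t : s \in gal K v -> t \in gal K v -> chi (s * t)%g = chi s * chi t.
  move=> sG tG; apply: (mulIf nzy); rewrite -gE -mulrA -gE -arrangeM.
  apply: (@gal_eq _ K _ v t (fun x => g (arrange s x)) (fun x => chi s * g x))
    => //.
  - exact: rational_function_arrange.
  - by apply: ratfun_mul => //; apply: ratfun_const; apply: Kchi.
  by rewrite gv gE.
(* A coefficient [C.[y]] becomes the function [C.[g x]] over [K], which agrees with it wherever
   [g x = y]. *)
have sub_f f : rational_over K' f -> exists2 f', rational_over K f' &
    forall x, g x = y -> f' x = f x.
  elim=> {f} [c /K'gen[C KC ->]|i|f1 f2 _ [h1 Kh1 E1] _ [h2 Kh2 E2]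
    |f1 f2 _ [h1 Kh1 E1] _ [h2 Kh2 E2]|f1 _ [h1 Kh1 E1]|f1 _ [h1 Kh1 E1]].
  - exists (fun x => C.[g x]) => [|x ->//]; exact: rational_function_horner.
  - by exists (fun x => x i) => //; apply: ratfun_arg.
  - by exists (fun x => h1 x + h2 x) => [|x gx];
    [apply: ratfun_add|rewrite E1 ?E2].
  - by exists (fun x => h1 x * h2 x) => [|x gx];
    [apply: ratfun_mul|rewrite E1 ?E2].
  - by exists (fun x => - h1 x) => [|x gx]; [apply: ratfun_opp|rewrite E1].
  - by exists (fun x => (h1 x)^-1) => [|x gx]; [apply: ratfun_inv|rewrite E1].
have sHG := gal_sub v sKK'.
have memH s : (s \in gal K' v) = (s \in gal K v) && (chi s == 1).
  apply/idP/andP => [sH|[sG /eqP chis]].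
    split; first exact: (subsetP sHG).
    rewrite /chi (@gal_known _ K' _ v s g) // ?gv ?divff //.
    exact: rational_function_sub Kg.
  apply/gal_setP => f /sub_f[f' Kf' f'E] fv.
  rewrite -f'E; last by rewrite gE chis mul1r.
  by apply: (gal_setP _ _ _ sG) => //; rewrite f'E.
have chi_neq0 s : s \in gal K v -> chi s != 0.
  move=> /chiXp E; apply: contra_eqN E => /eqP->.
  by rewrite expr0n gtn_eqF // eq_sym oner_eq0.
have nHG : (gal K' v <| gal K v)%g.
  rewrite /normal sHG; apply/subsetP => t tG; rewrite inE.
  apply/subsetP => _ /imsetP[s sH ->]; have := sH;
    rewrite !memH => /andP[sG /eqP cs].
  rewrite groupJ //=; apply/eqP/(mulfI (chi_neq0 t tG)).
  by rewrite -chiM ?groupJ // -conjgC chiM // cs mul1r mulr1.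
have [g0 g0G chig0] : exists2 g0, g0 \in gal K v & chi g0 != 1.
  have : ~~ (gal K v \subset gal K' v).
    apply/negP => sGH; apply: neq_gal; apply/eqP.
    by rewrite eqEsubset; apply/andP.
  by case/subsetPn => g0 g0G; rewrite memH g0G => chig0; exists g0.
have g0_prim : p.-primitive_root (chi g0).
  by apply: prime_primitive_root; rewrite ?chiXp.
have chiX s i : s \in gal K v -> chi (s ^+ i)%g = chi s ^+ i.
  by move=> sG; elim: i => [|i IHi];
    rewrite ?expg0 // expgS chiM ?groupX // IHi exprS.
have nG s : s \in gal K v -> s \in 'N(gal K' v)%g.
  exact: (subsetP (normal_norm nHG)).
have quoE : (gal K v / gal K' v)%g = <[coset (gal K' v) g0]>%g.
  apply/eqP; rewrite eqEsubset cycle_subG mem_quotient // andbT.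
  apply/subsetP => _ /morphimP[s _ sG ->].
  have /(prim_rootP g0_prim)[i chis] := chiXp s sG.
  have -> : s = ((s * g0 ^- i) * g0 ^+ i)%g by rewrite mulgKV.
  rewrite /= coset_kerl; first by rewrite morphX ?nG // mem_cycle.
  rewrite memH groupM ?groupV ?groupX //= chiM ?groupV ?groupX // chis -chiX //.
  by rewrite -chiM ?groupV ?groupX // mulgV chi1.
split=> //; first by rewrite quoE cycle_cyclic.
rewrite quoE; apply/eqP; rewrite -[#|_|]/(#[_]%g) eqn_dvd; apply/andP.
have dvp : (#[coset (gal K' v) g0]%g %| p)%N.
  rewrite order_dvdn -morphX ?nG //; apply/eqP/coset_id.
  by rewrite memH groupX //= chiX // (prim_expr_order g0_prim).
split=> //; move: dvp => /(primeP p_pr).2/orP[|/eqP-> //].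
rewrite order_eq1 => /eqP/coset_idr => /(_ (nG _ g0G)).
by rewrite memH (negbTE chig0) andbF.
Qed.

End KummerStep.

(** * The tower of Lagrange sums *)

Lemma primitive_root_exists (L : closedFieldType) N : [pchar L] =i pred0 ->
  (0 < N)%N -> exists z : L, N.-primitive_root z.
Proof.
move=> char0 N_gt0.
have nzN : N%:R != 0 :> L by rewrite (GRing.pcharf0P L).1 // -lt0n.
have [rs rsE] := closed_field_poly_normal ('X^N - 1 : {poly L}).
move: rsE; rewrite -polyC1 (monicP (monicXnsubC _ N_gt0)) scale1r polyC1 => rsE.
have := @has_prim_root _ N rs N_gt0.
have -> : all N.-unity_root rs.
  apply/allP => x xrs; rewrite unity_rootE -subr_eq0.
  have : root ('X^N - 1) x by rewrite rsE root_prod_XsubC.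
  by rewrite /root !hornerE.
have -> : uniq rs.
  by rewrite -separable_prod_XsubC -rsE cyclotomic.separable_Xn_sub_1.
have -> : (N <= size rs)%N.
  by rewrite -ltnS -(size_prod_XsubC rs id) -rsE -polyC1 size_XnsubC.
by move=> /(_ isT isT isT)/hasP[z _ z_prim]; exists z.
Qed.

Section LagrangeSum.
Variables (L : fieldType) (n : nat).

Lemma cyclic_shift_sum (N : nat) (w : L) (F : nat -> L) m : w ^+ N = 1 ->
  (forall j, F (j + N)%N = F j) ->
  w ^+ m * \sum_(j < N) w ^+ j * F (j + m)%N = \sum_(j < N) w ^+ j * F j.
Proof.
move=> wN FN; elim: m F FN => [|m IHm] F FN.
  by rewrite mul1r; apply: eq_bigr => j _; rewrite addn0.
have := IHm (fun j => F j.+1) (fun j => FN j.+1) => {}IHm.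
under eq_bigr => j _ do rewrite addnS.
rewrite exprS -mulrA IHm mulr_sumr.
under eq_bigr => j _ do rewrite mulrA -exprS.
case: N wN FN {IHm} => [|N] wN FN; first by rewrite !big_ord0.
rewrite big_ord_recr [RHS]big_ord_recl /= wN addrC.
by congr (_ * _ + _); rewrite -[RHS]FN.
Qed.

Variables (G H : {group 'S_n}) (g : 'S_n) (w : L) (f : ('I_n -> L) -> L).
Hypotheses (nHG : (H <| G)%g) (Gg : g \in G).
Hypothesis quoE : (G / H)%g = <[coset H g]>%g.
Hypothesis inv_f : forall x t, t \in H -> f (arrange t x) = f x.
Local Notation N := #|G : H|%g.

(** Write [t = h * g ^+ m] with [h] in [H]. Normality moves [h] to the left of the powers of [g],
    where [f] ignores it; what remains is a cyclic shift by [m], which only multiplies the sum by a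
    power of [w]. *)
Lemma lagrange_sum_invariant x t : w ^+ N = 1 -> t \in G ->
  lagrange_sum N g w f (arrange t x) ^+ N = lagrange_sum N g w f x ^+ N.
Proof.
move=> wN tG; have nG u : u \in G -> u \in 'N(H)%g.
  exact: (subsetP (normal_norm nHG)).
have : coset H t \in <[coset H g]>%g by rewrite -quoE mem_quotient.
case/cycleP=> m; rewrite -morphX ?nG // => /(rcoset_kercosetP (nG _ tG)).
rewrite nG ?groupX // => /(_ isT)/rcosetP[h hH tE].
have gN : (g ^+ N)%g \in H.
  rewrite coset_idr ?nG ?groupX // morphX ?nG //.
  rewrite -(card_quotient (normal_norm nHG)) quoE; exact: expg_order.
have FN j : f (arrange (g ^+ (j + N))%g x) = f (arrange (g ^+ j)%g x).
  by rewrite addnC expgD -arrangeM inv_f.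
rewrite [X in _ = X ^+ _](esym (cyclic_shift_sum m wN FN))
  exprMn -exprM mulnC exprM wN expr1n mul1r.
congr (_ ^+ _); apply: eq_bigr => j _; congr (_ * _).
rewrite arrangeM tE mulgA [(_ * h)%g]conjgCV -mulgA -expgD -arrangeM inv_f //.
by rewrite memJ_norm ?groupV ?nG ?groupX.
Qed.

End LagrangeSum.

Lemma lagrange_sum_inversion (L : fieldType) n N (g : 'S_n) (z : L) f x :
  N.-primitive_root z ->
  \sum_(i < N) lagrange_sum N g (z ^+ i) f x = N%:R * f x.
Proof.
move=> z_prim; rewrite exchange_big /=.
under eq_bigr => j _ do under eq_bigr => i _ do rewrite -exprM.
under eq_bigr => j _ do rewrite -mulr_suml (sum_primitive_root _ z_prim).
have N_gt0 := prim_order_gt0 z_prim.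
rewrite (bigD1 (Ordinal N_gt0)) //= dvdn0 expg0 arrange1 big1 ?addr0 // => j j0.
rewrite ifF ?mul0r // gtnNdvd ?ltn_ord // lt0n.
by apply: contra j0 => /eqP j0; apply/eqP/val_inj.
Qed.

Lemma polyOver_coefs_in (L : fieldType) (K : divringClosed L) (p : {poly L}) :
  (p \is a polyOver K) <-> coefs_in (fun x => is_true (x \in K)) p.
Proof. by split=> /polyOverP. Qed.

Lemma coefs_polyOver (L : fieldType) (S : L -> Prop) (P : {poly L}) :
  (forall x, coefs P x -> S x) -> P \is a polyOver (known S).
Proof.
move=> PS; apply/polyOverP => i;
  have [ltiP|/(nth_default 0)->] := ltnP i (size P).
  by apply/knownP/rational_gen/PS/mem_nth.
exact: rpred0.
Qed.

Lemma roots_of_polyOver (L : fieldType) (K : divringClosed L) n (P : {poly L})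
  (r : 'I_n -> L) : roots_of P r -> P \is a polyOver K ->
  \prod_i ('X - (r i)%:P) \is a polyOver K.
Proof.
move=> [nzP _ PE] KP.
have nzl : lead_coef P != 0 by rewrite lead_coef_eq0.
rewrite -[\prod_i _](scalerK nzl) -PE polyOverZ ?rpredV //.
exact/polyOverP.
Qed.

Lemma known_sub (L : fieldType) (S S' : L -> Prop) :
  (forall x, S x -> rational S' x) -> {subset known S <= known S'}.
Proof.
move=> SS' x /knownP Sx; apply/knownP.
elim: Sx => {x} [x /SS'//||x y _ S'x _ S'y|x y _ S'x _ S'y].
- exact: rational_one.
- exact: rational_sub.
- exact: rational_div.
Qed.

Lemma radical_rational (L : fieldType) (S S' : L -> Prop) x :
  (forall z, S' z -> radical S z) -> rational S' x -> radical S x.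
Proof.
move=> S'S; elim=> {x} [x /S'S//||x y _ S'x _ S'y|x y _ S'x _ S'y].
- exact: radical_one.
- exact: radical_sub.
- exact: radical_div.
Qed.

Section Tower.
Variables (L : closedFieldType) (char0 : [pchar L] =i pred0).
Variables (n : nat) (P : {poly L}) (r : 'I_n -> L) (P_roots : roots_of P r).
Variable Q : {group 'S_n}.
Hypothesis Q_galois : galois_group (rational (coefs P)) r Q.
Variable s : seq {group 'S_n}.
Hypothesis Qs : cyclic_series Q s.

Local Notation K := (known (coefs P)).
Local Notation G := (level_group Q s).
Local Notation N := (level_index Q s).

Let inj_r : injective r. Proof. by case: P_roots. Qed.

Let QE : Q = gal K r.
Proof. by apply: galois_group_gal; rewrite knownE. Qed.

Let roots_over (K' : divringClosed L) : {subset K <= K'} ->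
  \prod_i ('X - (r i)%:P) \is a polyOver K'.
Proof.
move=> sKK'; apply: polyOverS sKK' _ _.
by apply: roots_of_polyOver P_roots _; apply: coefs_polyOver.
Qed.

Let gal_Q (K' : divringClosed L) : {subset K <= K'} -> gal K' r \subset Q.
Proof. by rewrite QE; apply: gal_sub. Qed.

Lemma level_groupP k : (k < size s)%N ->
  (G k.+1 <| G k)%g /\ cyclic (G k / G k.+1)%g.
Proof.
move=> ks; move: Qs => /andP[/(pathP 1%G)/(_ k ks)/andP[nGk cGk] _].
by split.
Qed.

Lemma level_group_last : G (size s) = 1%G.
Proof.
move: Qs => /andP[_ /eqP lastQ]; apply/val_inj.
by rewrite /= -lastQ (last_nth 1%G).
Qed.

Lemma level_index_gt0 k : (0 < N k)%N.
Proof. exact: indexg_gt0. Qed.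

Lemma coset_generators_exist : exists g, coset_generators Q s g.
Proof.
have /choice[g gP] k : exists g : 'S_n, (k < size s)%N ->
    g \in G k /\ (G k / G k.+1)%g = <[coset (G k.+1) g]>%g.
  have [ks|] := boolP (k < size s)%N; last by exists 1%g.
  have [_ /cyclicP[y yE]] := level_groupP ks.
  have /morphimP[g _ gG yg] : y \in (G k / G k.+1)%g by rewrite yE cycle_id.
  by exists g => _; rewrite yE yg.
by exists g => k ks; apply: gP.
Qed.

Lemma bottom_constants_exist : exists q, bottom_constants (rational (coefs P))
  r Q q.
Proof.
have [c inj_c] := resolvent_exists char0 inj_r.
exists (fun i : 'I_n => c%:R ^+ i); split=> [i|i -> //|t u _].
  by apply/knownP; rewrite rpredX ?rpred_nat.
by rewrite arrangeM => /inj_c/eqP; rewrite eq_mulgV1 mulgK => /eqP.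
Qed.

Section Levels.
Variables (q : 'I_n -> L) (g : nat -> 'S_n).
Hypothesis q_const : bottom_constants (rational (coefs P)) r Q q.
Hypothesis g_gen : coset_generators Q s g.
Implicit Types (alpha : nat -> L) (x : 'I_n -> L).
Local Notation F alpha := (level_function Q s g alpha q).

Lemma level_functionS alpha k x : (k < size s)%N ->
  F alpha k x = lagrange_sum (N k) (g k) (alpha k) (F alpha k.+1) x ^+ N k.
Proof. by move=> ks; rewrite /level_function -subnSK. Qed.

Lemma level_function_last alpha x : F alpha (size s) x = linear_function q x.
Proof. by rewrite /level_function subnn. Qed.

(** This allows [alpha k] to vary over all roots of unity while the function at level [k.+1] stays
    the same. *)
Lemma eq_level_function alpha beta k : (forall j, (k <= j)%N ->
  alpha j = beta j) ->
  F alpha k = F beta k.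
Proof.
rewrite /level_function; move: (size s - k)%N => d.
elim: d k => //= d IHd k eq_ab; rewrite eq_ab // (IHd k.+1) // => j /ltnW.
exact: eq_ab.
Qed.

Lemma level_function_invariant alpha k : roots_of_unity Q s alpha ->
  (k <= size s)%N -> forall x t, t \in G k -> F alpha k (arrange t x)
    = F alpha k x.
Proof.
move=> alphaP; move: {2}(size s - k)%N (leqnn (size s - k)) => d.
elim: d k => [|d IHd] k sk ks x t tG.
  have kE : k = size s by apply/eqP; rewrite eqn_leq ks -subn_eq0 -leqn0.
  by move: tG; rewrite kE level_group_last => /set1gP->; rewrite arrange1.
move: ks; rewrite leq_eqVlt => /orP[/eqP kE|ks].
  by move: tG; rewrite kE level_group_last => /set1gP->; rewrite arrange1.
have [nGk _] := level_groupP ks; have [gG quoE] := g_gen ks.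
rewrite !level_functionS //; apply: (lagrange_sum_invariant nGk gG quoE) => //.
  by apply: IHd => //; rewrite -ltnS subnSK.
exact: alphaP.
Qed.

Lemma level_function_rational (K' : divringClosed L) alpha k :
  (forall i, q i \in K') -> (forall j, (j < size s)%N -> alpha j \in K') ->
  (k <= size s)%N -> rational_over K' (F alpha k).
Proof.
move=> K'q K'a; rewrite /level_function => ks.
have : (k + (size s - k) <= size s)%N by rewrite subnKC.
move: (size s - k)%N => d; elim: d k {ks} => [|d IHd] k kd.
  exact: rational_function_linear.
apply: rational_function_exp; apply: rational_function_sum => j _.
apply: ratfun_mul; last by apply: rational_function_arrange; apply: IHd;
  rewrite addSnnS.
by apply: ratfun_const; rewrite rpredX // K'a // (leq_trans _ kd)
  // addnS ltnS leq_addr.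
Qed.

Let Kq i : q i \in K. Proof. by apply/knownP; case: q_const. Qed.

Lemma top_value_rational alpha t : roots_of_unity Q s alpha -> t \in Q ->
  rational (fun z => coefs P z \/ exists2 k, (k < size s)%N & z = alpha k)
    (F alpha 0%N (arrange t r)).
Proof.
move=> alphaP tQ; rewrite level_function_invariant //; apply/knownP.
set S := fun z => _.
have sKS : {subset K <= known S} by apply: known_sub => x Px;
  apply: rational_gen; left.
apply: (gal_invariant_known char0 (roots_over sKS) inj_r).
  apply: level_function_rational => // [i|j js]; first exact/sKS/Kq.
  by apply/knownP/rational_gen; right; exists j.
by move=> u /(subsetP (gal_Q sKS)) uQ; apply: level_function_invariant.
Qed.

Lemma level_value_rational alpha k x : (k < size s)%N ->
  rational (fun z => coefs P z \/ exists2 w, w ^+ N k = 1 & z = w \/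
      z ^+ N k = F [eta alpha with k |-> w] k x)
    (F alpha k.+1 x).
Proof.
move=> ks; have [z z_prim] := primitive_root_exists char0 (level_index_gt0 k).
set S := fun z => _; apply/knownP.
have nzN : (N k)%:R != 0 :> L
  by rewrite (GRing.pcharf0P L).1 // -lt0n level_index_gt0.
rewrite -(mulKf nzN (F alpha _ x)).
rewrite -(lagrange_sum_inversion (g k) (F alpha k.+1) x z_prim).
rewrite rpredM ?rpredV ?rpred_nat // rpred_sum // => i _.
apply/knownP/rational_gen; right; exists (z ^+ i).
  by rewrite -exprM mulnC exprM (prim_expr_order z_prim) expr1n.
right; rewrite level_functionS // /= eqxx; congr (lagrange_sum _ _ _ _ _ ^+ _).
by apply: eq_level_function => j kj /=; rewrite gtn_eqF.
Qed.

(** Once the bottom values are adjoined, a group element must fix the value of Z at [r], so it is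
    the identity and every root is invariant. *)
Lemma root_rational_bottom alpha i :
  rational (fun z => coefs P z \/
      exists2 t, t \in Q & z = F alpha (size s) (arrange t r)) (r i).
Proof.
set S := fun z => _; apply/knownP.
have sKS : {subset K <= known S} by apply: known_sub => x Px;
  apply: rational_gen; left.
apply: (gal_invariant_known char0 (roots_over sKS) inj_r (ratfun_arg _ i))
  => u uG.
suff -> : u = 1%g by rewrite arrange1.
have [_ _ bottom] := q_const; apply: (bottom 1%g) => //.
rewrite arrange1; apply: (gal_known uG).
  by apply: rational_function_linear => j; apply/sKS/Kq.
apply/knownP/rational_gen; right; exists 1%g => //.
by rewrite arrange1 level_function_last.
Qed.

(** The induction generalizes over [alpha], because descending from level [k] uses its values for
    every root of unity [w] in place of [alpha k]. *)
Lemma level_value_radical alpha k t : roots_of_unity Q s alpha ->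
  (k <= size s)%N ->
  t \in Q -> radical (coefs P) (F alpha k (arrange t r)).
Proof.
move=> alphaP ks tQ; elim: k alpha alphaP ks => [|k IHk] alpha alphaP ks.
  apply: radical_rational (top_value_rational alphaP tQ) => z [Pz|[k ks' ->]].
    exact: radical_gen.
  apply: (radical_root (level_index_gt0 k)) (radical_one _) _.
  exact: alphaP.
apply: radical_rational (level_value_rational alpha _ ks) => z [Pz|[w wN zE]].
  exact: radical_gen.
case: zE => [->|zN].
  exact: (radical_root (level_index_gt0 k) (radical_one _) wN).
apply: (radical_root (level_index_gt0 k) _ zN); apply: IHk; last exact: ltnW.
by move=> j js /=; case: eqP => [->|_]; [exact: wN | exact: alphaP].
Qed.

End Levels.

Lemma cyclic_series_tower_solution : tower_solution P r Q s.
Proof.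
split; first exact: bottom_constants_exist.
  move=> q g alpha q_const g_gen alphaP F a; split.
  - split=> [k ks x|x]; last exact: level_function_last.
    exact: level_functionS.
  - by move=> k ks x t; apply: level_function_invariant.
  - by move=> t; apply: top_value_rational.
  - by move=> k ks t _; apply: level_value_rational.
  - exact: root_rational_bottom.
move=> i; have [q q_const] := bottom_constants_exist.
have [g g_gen] := coset_generators_exist.
have alphaP : roots_of_unity Q s (fun=> 1 : L) by move=> k _; rewrite expr1n.
apply: radical_rational (root_rational_bottom g q_const (fun=> 1) i).
move=> z [Pz|[t tQ ->]]; first exact: radical_gen.
exact: level_value_radical.
Qed.

End Tower.

(** * Chains of adjunctions *)

Section KummerConverse.
Variables (L : fieldType) (char0 : [pchar L] =i pred0) (K : divringClosed L).
Variables (n : nat) (v : 'I_n -> L).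
Hypotheses (Kv : \prod_i ('X - (v i)%:P) \is a polyOver K)
  (inj_v : injective v).

(* A function that is invariant under H but not under the whole group is a    *)
(* combination of its Lagrange sums, so that one of these is not known.       *)
Lemma kummer_converse (H : {group 'S_n}) (p : nat) (z : L) :
  prime p -> p.-primitive_root z -> z \in K ->
  (H <| gal K v)%g -> #|gal K v : H|%g = p ->
  exists y, [/\ y ^+ p \in K, y \notin K & y \in rational_image K v].
Proof.
move=> p_pr z_prim Kz nH iH; set G := gal K v in nH iH *.
have [g0 g0G g0H] : exists2 g, g \in G & g \notin H.
  apply/subsetPn; rewrite -indexg_eq1 iH; apply: contraTneq p_pr => ->.
  by [].
have nG u : u \in G -> u \in 'N(H)%g by exact: (subsetP (normal_norm nH)).
have quoE : (G / H)%g = <[coset H g0]>%g.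
  apply/eqP; rewrite eq_sym eqEcard cycle_subG mem_quotient //=.
  rewrite card_quotient ?normal_norm // iH.
  have : (#[coset H g0]%g %| p)%N.
    by rewrite -iH -card_quotient ?normal_norm // order_dvdG ?mem_quotient.
  move=> /(primeP p_pr).2/orP[|/eqP<- //].
  by rewrite order_eq1 => /eqP/coset_idr => /(_ (nG _ g0G));
    rewrite (negbTE g0H).
have [a Ka inj_a] := known_resolvent_exists char0 K inj_v.
pose PH x := \prod_(h in H) ('X - (linear_function a (arrange h x))%:P).
(* If [g0] fixed every coefficient, the resolvent value at 1 would occur among those at [h * g0],
   forcing [g0] into [H]. *)
have [k fk] : exists k, (PH (arrange g0 v))`_k != (PH v)`_k.
  apply: contrapT => eqPH; have PHE : PH (arrange g0 v) = PH v.
    by apply/polyP => k; apply/eqP; apply: contrapT => neq; apply: eqPH;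
      exists k; apply/negP.
  have : root (PH v) (linear_function a v).
    rewrite /root horner_prod (bigD1 1%g) ?group1 //= arrange1 hornerXsubC.
    by rewrite subrr mul0r.
  rewrite -PHE root_prod_XsubC_fin => /imageP[h hH].
  rewrite -{1}[v]arrange1 arrangeM => /inj_a E.
  by move: g0H; rewrite -(groupMl g0 hH) -E group1.
pose f x := (PH x)`_k.
have Kf : rational_over K f.
  apply: rational_function_coef_prod => h _; apply: rational_function_arrange.
  exact: rational_function_linear.
have fH x t : t \in H -> f (arrange t x) = f x.
  move=> tH; rewrite /f /PH [in RHS](reindex_inj (mulIg t)) /=.
  congr (nth 0 (polyseq _) k).
  by apply: eq_big => u; [rewrite groupMr | rewrite arrangeM].
pose y i := lagrange_sum p g0 (z ^+ i) f v.
have Ky i : rational_over K (lagrange_sum p g0 (z ^+ i) f).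
  apply: rational_function_sum => j _; apply: ratfun_mul.
    by apply: ratfun_const; rewrite !rpredX.
  exact: rational_function_arrange.
have KyX i : y i ^+ p \in K.
  apply: (gal_invariant_known char0 Kv inj_v (rational_function_exp p (Ky i))).
  move=> s sG; have := lagrange_sum_invariant nH g0G quoE fH; rewrite iH.
  by apply=> //; rewrite -exprM mulnC exprM (prim_expr_order z_prim) expr1n.
have [i nKy] : exists i, y i \notin K.
  apply: contrapT => allK; move/negP: fk; apply; apply/eqP.
  apply: (gal_known g0G Kf).
  have nzp : p%:R != 0 :> L by rewrite (GRing.pcharf0P L).1 // -lt0n prime_gt0.
  rewrite -(mulKf nzp (f v)) -(lagrange_sum_inversion g0 f v z_prim).
  rewrite rpredM ?rpredV ?rpred_nat // rpred_sum // => i _.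
  by apply: contrapT => /negP nKy; apply: allK; exists i.
exists (y i); split=> //; apply/rational_imageP.
by exists (lagrange_sum p g0 (z ^+ i) f).
Qed.

End KummerConverse.

(** A subgroup [R] of index [p] in the [p]-part, times the complementary [p']-part. *)
Lemma abelian_index_prime (gT : finGroupType) (G : {group gT}) p :
  abelian G -> prime p -> (p %| #|G|)%N ->
  exists H : {group gT}, (H <| G)%g /\ #|G : H|%g = p.
Proof.
move=> abG p_pr pG; have nilG := abelian_nil abG.
have hallp := nilpotent_pcore_Hall p nilG.
have hallq := nilpotent_pcore_Hall p^' nilG.
have cardp := card_Hall hallp; have cardq := card_Hall hallq.
have logp : (0 < logn p #|'O_p(G)%g|)%N.
  by rewrite cardp p_part pfactorK // logn_gt0 mem_primes p_pr cardG_gt0.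
have [R [sRP nRP cardR]] := normal_pgroup (pcore_pgroup p G) (normal_refl _)
  (leq_pred (logn p #|'O_p(G)%g|)).
have sRG : R \subset G := subset_trans sRP (pcore_sub _ _).
have sqG : 'O_p^'(G)%g \subset G := pcore_sub _ _.
have cRq : 'O_p^'(G)%g \subset 'C(R)%g.
  by apply: subset_trans sqG (subset_trans abG _); apply: centS.
have TI : (R :&: 'O_p^'(G) = 1)%g.
  apply: coprime_TIg; apply: pnat_coprime (pcore_pgroup _ _).
  exact: pgroupS sRP (pcore_pgroup _ _).
exists (R <*> 'O_p^'(G))%G; split.
  by rewrite -sub_abelian_normal // join_subG sRG.
have cardH : #|R <*> 'O_p^'(G)|%g = (#|R| * #|'O_p^'(G)%g|)%N.
  by rewrite cent_joinEr // TI_cardMg.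
have sHG : (R <*> 'O_p^'(G))%g \subset G by rewrite join_subG sRG.
apply/eqP; rewrite -(eqn_pmul2l (cardG_gt0 (R <*> 'O_p^'(G))%G))
  Lagrange // cardH.
rewrite mulnAC cardR -expnSr prednK // cardq.
by rewrite cardp p_part pfactorK // -p_part partnC.
Qed.

(** Irreducible adjunctions at which the [p]-th roots of unity are already known, as [kummer_step]
    requires. *)
Fixpoint kummer_adjunctions (L : fieldType) (S : L -> Prop) (s : seq (nat * L))
  : Prop :=
  if s is (p, A) :: s' then
    [/\ prime p /\ rational S A, exists2 z, p.-primitive_root z & rational S z,
        irreducible_over (rational S) ('X^p - A%:P) &
        kummer_adjunctions (fun x => S x \/ x ^+ p = A) s']
  else True.

Lemma kummer_irreducible (L : fieldType) (S : L -> Prop) s :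
  kummer_adjunctions S s -> irreducible_adjunctions S s.
Proof. by elim: s S => // -[p A] s IHs S /= [[p_pr KA] _ irr /IHs]. Qed.

Lemma adjoin_cat (L : fieldType) (S : L -> Prop) s1 s2 :
  adjoin S (s1 ++ s2) = adjoin (adjoin S s1) s2.
Proof. by elim: s1 S => // -[p A] s1 IHs S /=. Qed.

Lemma irreducible_adjunctions_cat (L : fieldType) (S : L -> Prop) s1 s2 :
  irreducible_adjunctions S (s1 ++ s2) <->
  irreducible_adjunctions S s1 /\ irreducible_adjunctions (adjoin S s1) s2.
Proof.
elim: s1 S => [|[p A] s1 IHs] S /=; first by split=> [|[]].
split=> [[? ? ? /IHs[]]|[[? ? ? ?] ?]] //.
by split=> //; apply/IHs.
Qed.

Lemma kummer_adjunctions_cat (L : fieldType) (S : L -> Prop) s1 s2 :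
  kummer_adjunctions S s1 -> kummer_adjunctions (adjoin S s1) s2 ->
  kummer_adjunctions S (s1 ++ s2).
Proof.
by elim: s1 S => [|[p A] s1 IHs] S //= [? ? ? ks1] ks2; split=> //; apply: IHs.
Qed.

Lemma sub_adjoin (L : fieldType) (S : L -> Prop) s x : S x -> adjoin S s x.
Proof. by elim: s S => // -[p A] s IHs S Sx /=; apply: IHs; left. Qed.

Lemma known_sub_adjoin (L : fieldType) (S : L -> Prop) s :
  {subset known S <= known (adjoin S s)}.
Proof. by apply: known_sub => x Sx; apply/rational_gen/sub_adjoin. Qed.

Lemma eq_exp_primitive (L : fieldType) p (z x y : L) : p.-primitive_root z ->
  x ^+ p = y ^+ p -> exists i, x = z ^+ i * y.
Proof.
move=> z_prim xy; have p_gt0 := prim_order_gt0 z_prim.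
have [y0|nzy] := eqVneq y 0.
  exists 0%N; rewrite y0 mulr0; apply/eqP.
  by have := expf_eq0 x p; rewrite p_gt0 xy y0 expr0n gtn_eqF // eqxx /= => <-.
have /(prim_rootP z_prim)[i xyi] : (x / y) ^+ p = 1.
  by rewrite expr_div_n xy divff ?expf_neq0.
by exists i; rewrite -xyi mulfVK.
Qed.

(** The other roots are [z ^+ i * y], and inverses are polynomials in [y] because [y] is
    algebraic. *)
Lemma adjoin_root_polynomial (L : fieldType) (S : L -> Prop) p (z y : L) :
  p.-primitive_root z -> z \in known S -> y ^+ p \in known S ->
  forall x, x \in known (fun x => S x \/ x ^+ p = y ^+ p) ->
  exists2 C, C \is a polyOver (known S) & x = C.[y].
Proof.
move=> z_prim Kz Kyp x /knownP.
have p_gt0 := prim_order_gt0 z_prim.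
have [m mP] : exists m, minimal_poly (known S) y m.
  apply: (@minimal_poly_exists _ _ _ ('X^p - (y ^+ p)%:P)).
  - by rewrite rpredB ?polyOverXn ?polyOverC.
  - by rewrite monic_neq0 ?monicXnsubC.
  by rewrite /root !hornerE subrr.
have [_ _ my minm] := mP.
elim=> {x} [x [Sx|/(eq_exp_primitive z_prim)[i ->]]||
  x1 x2 _ [C1 K1 ->] _ [C2 K2 ->]|x1 x2 _ [C1 K1 ->] _ [C2 K2 ->]].
- exists x%:P; last by rewrite hornerC.
  by rewrite polyOverC; apply/knownP/rational_gen.
- exists ((z ^+ i) *: 'X); last by rewrite hornerZ hornerX.
  by rewrite polyOverZ ?polyOverX ?rpredX.
- by exists 1; rewrite ?rpred1 ?hornerC.
- by exists (C1 - C2); rewrite ?rpredB // hornerD hornerN.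
have [C20|C20] := boolP (root C2 y).
  by exists 0; rewrite ?rpred0 // horner0 (eqP C20) invr0 mulr0.
have [u Ku uE] := minimal_poly_inv mP K2 C20.
by exists (C1 * u); rewrite ?rpredM // hornerM uE.
Qed.

Section Kummer.
Variables (L : closedFieldType) (char0 : [pchar L] =i pred0).

Lemma closed_exp_exists p (A : L) : (0 < p)%N -> exists y, y ^+ p = A.
Proof.
move=> p_gt0; have /closed_rootP[y] : size ('X^p - A%:P) != 1.
  by rewrite size_XnsubC // eqSS -lt0n.
by rewrite /root !hornerE subr_eq0 => /eqP yA; exists y.
Qed.

Lemma kummer_adjoin_root (S : L -> Prop) p (z y : L) : prime p ->
  p.-primitive_root z -> z \in known S -> y ^+ p \in known S ->
  exists s, [/\ kummer_adjunctions S s, all (fun e => e.1 == p) s &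
    forall x, x ^+ p = y ^+ p -> x \in known (adjoin S s)].
Proof.
move=> p_pr z_prim Kz Kyp; have [Ky|nKy] := boolP (y \in known S).
  exists [::]; split=> // x /(eq_exp_primitive z_prim)[i ->].
  by rewrite rpredM ?rpredX.
exists [:: (p, y ^+ p)]; rewrite /= eqxx; split=> //.
  split=> //; first by split=> //; apply/knownP.
    by exists z => //; apply/knownP.
  by rewrite -knownE; apply: (irreducible_Xn_sub_exp p_pr z_prim Kz Kyp).
by move=> x xy; apply/knownP/rational_gen; right.
Qed.

Section KillPrime.
Variables (n : nat) (v : 'I_n -> L) (inj_v : injective v).

(** While [p] divides the order of this abelian group, it has a subgroup of index [p], and
    [kummer_converse] yields a radical [y] in [K(v)] outside [K]. By [gal_eqP] its adjunction
    strictly shrinks the group. *)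
Lemma kummer_kill_prime (S : L -> Prop) p (z : L) : prime p ->
  p.-primitive_root z -> z \in known S ->
  \prod_i ('X - (v i)%:P) \is a polyOver (known S) -> abelian (gal (known S) v)
    ->
  exists s, [/\ kummer_adjunctions S s, all (fun e => e.1 == p) s &
    ~~ (p %| #|gal (known (adjoin S s)) v|)%N].
Proof.
move=> p_pr z_prim; move: {2}#|_| (leqnn #|gal (known S) v|) => k.
elim: k S => [|k IHk] S; first by rewrite leqNgt cardG_gt0.
move=> leS Kz Kv abS; have [pS|] := boolP (p %| #|gal (known S) v|)%N;
  last first.
  by exists [::].
have [H [nH iH]] := abelian_index_prime abS p_pr pS.
have [y [Kyp nKy Vy]] := kummer_converse char0 Kv inj_v p_pr z_prim Kz nH iH.
pose S1 x := S x \/ x ^+ p = y ^+ p.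
have sSS1 : {subset known S <= known S1}.
  by apply: known_sub => x Sx; apply/rational_gen; left.
have ltS1 : gal (known S1) v \proper gal (known S) v.
  rewrite properEneq gal_sub // andbT; apply/eqP => /esym eqG.
  have := (gal_eqP char0 sSS1 Kv inj_v).1 eqG y Vy; rewrite (negbTE nKy).
  by move=> E; apply: notF; apply: E; apply/knownP/rational_gen; right.
have [|||s [ks ps npS]] := IHk S1 _ (sSS1 z Kz).
- by rewrite -ltnS; apply: leq_trans leS; apply: proper_card.
- exact: polyOverS sSS1 _ Kv.
- exact: abelianS (proper_sub ltS1) abS.
exists ((p, y ^+ p) :: s); rewrite /= eqxx; split=> //; split=> //.
- by split=> //; apply/knownP.
- by exists z => //; apply/knownP.
by rewrite -knownE; apply: (irreducible_Xn_sub_exp p_pr z_prim Kz Kyp).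
Qed.

(* The conjugates of a root of unity of order p are fewer than p, and their   *)
(* number divides the order of the group.                                     *)
Lemma gal_fixes_prime_root (K : divringClosed L) p i0 :
  \prod_i ('X - (v i)%:P) \is a polyOver K ->
  prime p -> p.-primitive_root (v i0) ->
  (forall l, prime l -> (l < p)%N -> ~~ (l %| #|gal K v|)%N) -> v i0 \in K.
Proof.
move=> Kv p_pr z_prim small; have p_gt0 := prime_gt0 p_pr.
pose O := orbit 'P%act (gal K v) i0.
pose Phi : {poly L} := \poly_(j < p) 1.
have KPhi : Phi \is a polyOver K.
  by apply/polyOverP => j; rewrite coef_poly; case: ifP;
    rewrite ?rpred1 ?rpred0.
have sPhi : size Phi = p by apply: size_poly_eq; rewrite oner_eq0.
have PhiE x : Phi.[x] = \sum_(j < p) x ^+ j.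
  by rewrite horner_poly; apply: eq_bigr => j _; rewrite mul1r.
have Phi0 : Phi.[v i0] = 0.
  rewrite PhiE; have := sum_primitive_root 1 z_prim;
    rewrite gtnNdvd ?prime_gt1 //.
  by under eq_bigr => j _ do rewrite muln1.
have ltO : (#|O| < p)%N.
  rewrite -sPhi -(size_image v); apply: max_poly_roots.
  - by rewrite -size_poly_gt0 sPhi.
  - apply/allP => _ /imageP[_ /orbitP[s sG <-] ->]; apply/eqP.
    apply: (gal_setP _ _ _ sG (fun x => Phi.[x i0])) => //.
    by apply: rational_function_horner => //; apply: ratfun_arg.
  by rewrite map_inj_uniq ?enum_uniq.
have O1 : #|O| = 1%N.
  apply/eqP; apply: contraT => O1.
  have O_gt1 : (1 < #|O|)%N.
    by rewrite ltn_neqAle eq_sym O1; apply/card_gt0P; exists i0;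
      apply: orbit_refl.
  have lO := pdiv_dvd #|O|.
  have := small _ (pdiv_prime O_gt1) (leq_ltn_trans (dvdn_leq (ltnW O_gt1) lO)
    ltO).
  by rewrite (dvdn_trans lO (dvdn_orbit _ _ _)).
have fix_i0 s : s \in gal K v -> s i0 = i0.
  move=> sG; have /eqP/cards1P[i Oi] := O1.
  have : i0 \in O by apply: orbit_refl.
  have : s i0 \in O by apply: (mem_orbit 'P i0 sG).
  by rewrite Oi => /set1P-> /set1P->.
apply: (gal_invariant_known char0 Kv inj_v (ratfun_arg _ i0)) => s sG.
by rewrite /arrange fix_i0.
Qed.

End KillPrime.

Section RootsOfUnity.
Variables (N : nat) (w : L) (w_prim : N.-primitive_root w) (N_gt1 : (1 < N)%N).
Let u (i : 'I_N) : L := w ^+ i.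

Lemma inj_roots_of_unity : injective u.
Proof.
move=> i j /eqP; rewrite (eq_prim_root_expr w_prim) !modn_small ?ltn_ord //.
by move=> /eqP/val_inj.
Qed.

Lemma roots_of_unity_polyOver (K : divringClosed L) :
  \prod_i ('X - (u i)%:P) \is a polyOver K.
Proof.
rewrite -(big_mkord xpredT (fun i => 'X - (w ^+ i)%:P))
  (factor_Xn_sub_1 w_prim).
by rewrite rpredB ?polyOverXn ?rpred1.
Qed.

(** An element acts as raising to the power [s i1], and exponents multiply commutatively. *)
Lemma roots_of_unity_abelian (K : divringClosed L) : abelian (gal K u).
Proof.
pose i1 := Ordinal N_gt1.
have uX s i : s \in gal K u -> u (s i) = u (s i1) ^+ i.
  move=> sG; apply: (@gal_eq _ K _ u s (fun x => x i) (fun x => x i1 ^+ i))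
    => //.
  - exact: ratfun_arg.
  - by apply: rational_function_exp; apply: ratfun_arg.
apply/centsP => s sG t tG; apply/permP => i; apply: inj_roots_of_unity.
rewrite !permM (uX t _ tG) (uX s (t i) sG).
have E s' i' : s' \in gal K u -> u (s' i') = w ^+ (s' i1 * i') by move=> /uX->;
  rewrite exprM.
have F s' t' : s' \in gal K u -> t' \in gal K u -> u (t' i1)
  ^+ s' i = w ^+ (t' i1 * s' i1 * i).
  by move=> sG' tG'; rewrite /u -exprM mulnC exprM -/(u (s' i)) (E s')
    // -exprM; congr (_ ^+ _); rewrite mulnC mulnA.
by rewrite F // F // [(t i1 * _)%N]mulnC.
Qed.

End RootsOfUnity.
End Kummer.

(** * Supplying roots of unity by primes in increasing order *)

Section OrderedAdjunctions.
Variables (L : closedFieldType) (char0 : [pchar L] =i pred0).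
Implicit Types (S : L -> Prop) (s : seq (nat * L)).

Lemma sorted_unzip1_cat p s s' : sorted leq (unzip1 s) ->
  all (fun e => (e.1 <= p)%N) s -> all (fun e => e.1 == p) s' ->
  sorted leq (unzip1 (s ++ s')).
Proof.
rewrite !(sorted_pairwise leq_trans)
  /unzip1 map_cat pairwise_cat => -> /allP ltp /allP eqp.
rewrite /=; apply/andP; split.
  by apply/allrelP => _ _ /mapP[e /ltp le_e ->] /mapP[e' /eqp/eqP-> ->].
have : all (fun i => i == p) [seq e.1 | e <- s'] by rewrite all_map; apply/allP.
elim: [seq e.1 | e <- s'] => //= i l IHl /andP[/eqP-> lp].
by rewrite IHl // andbT; apply: sub_all lp => j /eqP->.
Qed.

Lemma all_fst_le p s s' : all (fun e => (e.1 < p.+1)%N) s ->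
  all (fun e => e.1 == p) s' -> all (fun e => (e.1 < p.+1)%N) (s ++ s').
Proof.
by move=> sp s'p; rewrite all_cat sp; apply: sub_all s'p => e /eqP->.
Qed.

Lemma sorted_unzip1_rcons s (e : nat * L) : sorted leq (unzip1 (rcons s e)) ->
  sorted leq (unzip1 s) /\ all (fun e' => (e'.1 <= e.1)%N) s.
Proof.
rewrite !(sorted_pairwise leq_trans) /unzip1 map_rcons -cats1 pairwise_cat.
by rewrite allrel1r all_map => /and3P[].
Qed.

Variables (p : nat) (w : L).
Hypotheses (p_pr : prime p) (w_prim : (p`!).-primitive_root w)
  (N_gt1 : (1 < p`!)%N).
Local Notation u := (fun i : 'I_(p`!) => w ^+ i).
Local Notation gal_u S := (gal (known S) u).

Definition no_prime_below m S := forall l, prime l -> (l < m)%N ->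
  ~~ (l %| #|gal_u S|)%N.

Lemma no_prime_below_sub m S S' : {subset known S <= known S'} ->
  no_prime_below m S -> no_prime_below m S'.
Proof.
move=> sSS' nS l l_pr lm; apply: contra (nS l l_pr lm) => dv.
exact: dvdn_trans dv (cardSg (gal_sub _ sSS')).
Qed.

(** The tuple of [p!]-th roots of unity contains those of every order up to [p], so one group
    controls all the primes in question. *)
Lemma prime_root_known m S : prime m -> (m <= p)%N -> no_prime_below m S ->
  exists2 z, m.-primitive_root z & z \in known S.
Proof.
move=> m_pr mp nS; have m_dv : (m %| p`!)%N by rewrite dvdn_fact ?prime_gt0.
have lt_q : (p`! %/ m < p`!)%N by rewrite ltn_Pdiv ?prime_gt1 ?fact_gt0.
have z_prim : m.-primitive_root (u (Ordinal lt_q)).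
  by have := dvdn_prim_root w_prim m_dv.
exists (u (Ordinal lt_q)) => //.
apply: (@gal_fixes_prime_root _ char0 _ u) z_prim _ => //.
- exact: inj_roots_of_unity w_prim.
- exact: roots_of_unity_polyOver w_prim _.
Qed.

(* Adjoining, for every prime in increasing order, what removes it from the   *)
(* order of the Galois group of the roots of unity makes the roots of unity   *)
(* of each prime order known before they are needed.                          *)
Lemma kummer_refinement m S s : (m <= p.+1)%N ->
  increasing_adjunctions S s -> all (fun e => (e.1 < m)%N) s ->
  exists s', [/\ kummer_adjunctions S s', sorted leq (unzip1 s'),
    all (fun e => (e.1 < m)%N) s',
    {subset known (adjoin S s) <= known (adjoin S s')} &
    no_prime_below m (adjoin S s')].
Proof.
elim: m s => [|m IHm] s mp.
  by case: s => [|e s] _ //= _; exists [::]; split=> // l.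
have [m_pr|m_npr] := boolP (prime m); last first.
  move=> [irr sorted_s] lt_s; have lt_s' : all (fun e => (e.1 < m)%N) s.
    apply/allP => e es; have := allP lt_s e es.
    rewrite ltnS leq_eqVlt => /orP[/eqP em|//].
    suff : prime e.1 by rewrite em (negbTE m_npr).
    case/splitPr: es irr => s1 s2 /irreducible_adjunctions_cat[_].
    by case: e {em} => q A /= [].
  have [s' [ks' ss' ls' sub_s' nb]] := IHm s (ltnW mp) (conj irr sorted_s)
    lt_s'.
  exists s'; split=> //; first by apply: sub_all ls' => e /ltnW.
  move=> l l_pr; rewrite ltnS leq_eqVlt => /orP[/eqP lm|]; last exact: nb.
  by rewrite -lm l_pr in m_npr.
(* When only primes below [m] occur, the outer induction makes the [m]-th roots of unity known; then
   [m] is removed from the group order. *)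
have base s0 : increasing_adjunctions S s0 -> all (fun e => (e.1 < m)%N) s0 ->
    exists s', [/\ kummer_adjunctions S s', sorted leq (unzip1 s'),
      all (fun e => (e.1 < m.+1)%N) s',
      {subset known (adjoin S s0) <= known (adjoin S s')} &
      no_prime_below m.+1 (adjoin S s')].
  move=> inc_s lt_s; have [s1 [ks1 ss1 ls1 sub_s1 nb1]] := IHm s0 (ltnW mp)
    inc_s lt_s.
  have [z z_prim Kz] := prime_root_known m_pr mp nb1.
  have [s2 [ks2 ls2 nm2]] := kummer_kill_prime char0
    (inj_roots_of_unity w_prim)
      m_pr z_prim Kz (roots_of_unity_polyOver w_prim _)
    (roots_of_unity_abelian w_prim N_gt1 _).
  have sub12 := known_sub_adjoin (S := adjoin S s1) s2.
  exists (s1 ++ s2); rewrite adjoin_cat; split.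
  - exact: kummer_adjunctions_cat.
  - by apply: sorted_unzip1_cat ls2 => //; apply: sub_all ls1 => e /ltnW.
  - by apply: all_fst_le => //; apply: sub_all ls1 => e /ltnW.
  - by move=> x /sub_s1/sub12.
  move=> l l_pr; rewrite ltnS leq_eqVlt => /orP[/eqP->//|lm].
  exact: (no_prime_below_sub sub12 nb1).
(* Inner induction for the adjunctions of prime [m]: they come last in the list, after the [m]-th
   roots of unity have become known. *)
elim/last_ind: s => [|s [q A] IHs] inc_s lt_s; first exact: base.
have [irr_s sorted_s] := inc_s;
  have [sorted_s0 le_q] := sorted_unzip1_rcons sorted_s.
move: lt_s; rewrite all_rcons => /andP[/= lt_q lt_s].
move: lt_q; rewrite ltnS leq_eqVlt => /orP[/eqP qm|lt_q]; last first.
  apply: base => //; rewrite all_rcons /= lt_q.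
  by apply: sub_all le_q => e /= /leq_ltn_trans; apply.
move: irr_s; rewrite -cats1 =>
  /irreducible_adjunctions_cat[irr_s0 /= [_ KA _ _]].
have [s1 [ks1 ss1 ls1 sub1 nb1]] := IHs (conj irr_s0 sorted_s0) lt_s.
have nb1' : no_prime_below m (adjoin S s1).
  by move=> l l_pr /ltnW; apply: nb1.
have [z z_prim Kz] := prime_root_known m_pr mp nb1'.
have [y yA] := closed_exp_exists A (prime_gt0 m_pr).
have Kyp : y ^+ m \in known (adjoin S s1) by rewrite yA; apply/sub1/knownP.
have [s2 [ks2 ls2 s2y]] := kummer_adjoin_root m_pr z_prim Kz Kyp.
have sub12 := known_sub_adjoin (S := adjoin S s1) s2.
exists (s1 ++ s2); rewrite !adjoin_cat; split.
- exact: kummer_adjunctions_cat.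
- exact: sorted_unzip1_cat ls2.
- exact: all_fst_le.
- apply: known_sub => x /= [Sx|]; last by rewrite qm -yA => /s2y/knownP.
  by apply/knownP/sub12/sub1/knownP/rational_gen.
exact: no_prime_below_sub nb1.
Qed.

End OrderedAdjunctions.

(** * From radical expressions to series of groups *)

Section Radicals.
Variables (L : closedFieldType) (char0 : [pchar L] =i pred0).
Implicit Types (S : L -> Prop) (s : seq (nat * L)).

Lemma kummer_prime_root p S s : prime p -> increasing_adjunctions S s ->
  all (fun e => (e.1 < p)%N) s ->
  exists s', [/\ kummer_adjunctions S s', sorted leq (unzip1 s'),
    all (fun e => (e.1 < p)%N) s',
    {subset known (adjoin S s) <= known (adjoin S s')} &
    exists2 z, p.-primitive_root z & z \in known (adjoin S s')].
Proof.
move=> p_pr inc_s lt_s.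
have [w w_prim] := primitive_root_exists char0 (fact_gt0 p).
have N_gt1 : (1 < p`!)%N.
  apply: leq_trans (prime_gt1 p_pr) _; apply: dvdn_leq; first exact: fact_gt0.
  by rewrite dvdn_fact // prime_gt0 /=.
have [s' [ks' ss' ls' sub' nb]] :=
  kummer_refinement char0 w_prim N_gt1 (leqnSn p) inc_s lt_s.
exists s'; split=> //; exact: (prime_root_known char0 w_prim p_pr (leqnn p) nb).
Qed.

(** Over the larger base an equation may become reducible; its roots are then already known, and
    [kummer_adjoin_root] adds nothing for it. *)
Lemma kummer_lift S S' s : (forall x, S x -> x \in known S') ->
  kummer_adjunctions S s ->
  exists2 s', kummer_adjunctions S' s' &
    {subset known (adjoin S s) <= known (adjoin S' s')}.
Proof.
elim: s S S' => [|[p A] s IHs] S S' SS' /=.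
  by exists [::] => //; apply: known_sub => x /SS'/knownP.
have sub : {subset known S <= known S'} by apply: known_sub => x /SS'/knownP.
move=> [[p_pr KA] [z z_prim Kz] _ ks].
have [y yA] := closed_exp_exists A (prime_gt0 p_pr).
have Kyp : y ^+ p \in known S' by rewrite yA; apply/sub/knownP.
have [s1 [ks1 _ s1y]] := kummer_adjoin_root p_pr z_prim (sub z (introT (knownP
  _ _) Kz)) Kyp.
have [|s2 ks2 sub2] := IHs _ (adjoin S' s1) _ ks.
  move=> x [/SS'|xA]; first exact: known_sub_adjoin.
  by apply: s1y; rewrite xA.
exists (s1 ++ s2); first exact: kummer_adjunctions_cat.
by rewrite adjoin_cat.
Qed.

(** With [n = k * p], [y ^+ k] is a [p]-th root of a known quantity and [y] a [k]-th root of it; the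
    roots of unity of order [p] are adjoined beforehand. *)
Lemma kummer_exp n S y : (0 < n)%N -> y ^+ n \in known S ->
  exists2 s, kummer_adjunctions S s & y \in known (adjoin S s).
Proof.
elim/ltn_ind: n S y => n IHn S y n_gt0 Kyn.
have [n1|n_neq1] := eqVneq n 1%N; first by exists [::] => //=;
  rewrite -[y]expr1 -n1.
have n_gt1 : (1 < n)%N by rewrite ltn_neqAle eq_sym n_neq1.
pose p := pdiv n; pose k := (n %/ p)%N.
have p_pr : prime p := pdiv_prime n_gt1.
have nE : n = (k * p)%N by rewrite divnK ?pdiv_dvd.
have k_gt0 : (0 < k)%N by rewrite divn_gt0 ?pdiv_gt0 // dvdn_leq ?pdiv_dvd.
have [s1 [ks1 _ _ _ [z z_prim Kz]]] :=
  @kummer_prime_root p S [::] p_pr (conj I isT) isT.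
have Kykp : (y ^+ k) ^+ p \in known (adjoin S s1).
  by rewrite -exprM -nE known_sub_adjoin.
have [s2 [ks2 _ s2y]] := kummer_adjoin_root p_pr z_prim Kz Kykp.
have lt_kn : (k < n)%N by rewrite ltn_Pdiv ?prime_gt1.
have [s3 ks3 s3y] := IHn k lt_kn _ y k_gt0 (s2y _ erefl).
exists (s1 ++ (s2 ++ s3)); last by rewrite !adjoin_cat.
by apply: kummer_adjunctions_cat => //; apply: kummer_adjunctions_cat.
Qed.

Lemma kummer_combine S s1 s2 :
  kummer_adjunctions S s1 -> kummer_adjunctions S s2 ->
  exists s, [/\ kummer_adjunctions S s,
    {subset known (adjoin S s1) <= known (adjoin S s)} &
    {subset known (adjoin S s2) <= known (adjoin S s)}].
Proof.
move=> ks1 ks2; have [|s3 ks3 sub3] := @kummer_lift S (adjoin S s1) s2 _ ks2.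
  by move=> x Sx; apply/known_sub_adjoin/knownP/rational_gen.
exists (s1 ++ s3); rewrite adjoin_cat; split=> //;
  first exact: kummer_adjunctions_cat.
exact: known_sub_adjoin.
Qed.

Lemma radical_kummer S x : radical S x ->
  exists2 s, kummer_adjunctions S s & x \in known (adjoin S s).
Proof.
elim=> {x} [x Sx||x y _ [s1 ks1 s1x] _ [s2 ks2 s2y]|x y _ [s1 ks1 s1x] _ [s2
  ks2 s2y]
  |n x y n_gt0 _ [s1 ks1 s1x] yn].
- by exists [::]; [|apply/knownP/rational_gen].
- by exists [::]; [|apply: rpred1].
- have [s [ks sub1 sub2]] := kummer_combine ks1 ks2.
  by exists s => //; apply: rpredB; [apply: sub1|apply: sub2].
- have [s [ks sub1 sub2]] := kummer_combine ks1 ks2.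
  by exists s => //; apply: rpred_div; [apply: sub1|apply: sub2].
rewrite -yn in s1x; have [s2 ks2 s2y] := kummer_exp n_gt0 s1x.
by exists (s1 ++ s2); [apply: kummer_adjunctions_cat|rewrite adjoin_cat].
Qed.

Lemma radicals_kummer S n (v : 'I_n -> L) : (forall i, radical S (v i)) ->
  exists2 s, kummer_adjunctions S s & forall i, v i \in known (adjoin S s).
Proof.
move=> rad_v; suff [s ks sv] : exists2 s, kummer_adjunctions S s &
    forall i, i \in enum 'I_n -> v i \in known (adjoin S s).
  by exists s => // i; apply: sv; rewrite mem_enum.
elim: (enum 'I_n) => [|i l [s1 ks1 s1v]]; first by exists [::].
have [s2 ks2 s2v] := radical_kummer (rad_v i).
have [s [ks sub1 sub2]] := kummer_combine ks1 ks2.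
exists s => // j; rewrite inE => /orP[/eqP->|/s1v/sub1//]; exact: sub2.
Qed.

(** Each adjunction leaves the group alone and is skipped, or contributes one term of prime index;
    once all [v i] are known the group is trivial. *)
Lemma kummer_cyclic_series S s n (v : 'I_n -> L) : injective v ->
  \prod_i ('X - (v i)%:P) \is a polyOver (known S) ->
  kummer_adjunctions S s -> (forall i, v i \in known (adjoin S s)) ->
  exists t, cyclic_series (gal (known S) v) t /\
    forall k, (k < size t)%N -> prime (level_index (gal (known S) v) t k).
Proof.
move=> inj_v; elim: s S => [|[p A] s IHs] S Kv /=.
  move=> _ known_v; exists [::]; split=> //; rewrite /cyclic_series /=.
  apply/eqP/trivgP/subsetP => u uG; apply/set1gP/permP => i; apply: inj_v.
  by rewrite perm1; apply: (gal_known uG (ratfun_arg _ i)).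
move=> [[p_pr KA] [z z_prim Kz] irr ks] known_v.
pose S1 x := S x \/ x ^+ p = A.
have sSS1 : {subset known S <= known S1}.
  by apply: known_sub => x Sx; apply/rational_gen; left.
have K1v := polyOverS sSS1 Kv.
have [t [ct pt]] := IHs S1 K1v ks known_v.
have [eqG|neqG] := eqVneq (gal (known S1) v) (gal (known S) v).
  by rewrite -eqG; exists t.
have [y yA] := closed_exp_exists A (prime_gt0 p_pr).
have Kyp : y ^+ p \in known S by rewrite yA; apply/knownP.
have K1y : y \in known S1 by apply/knownP/rational_gen; right.
have [||nG cG oG] := @kummer_step _ char0 (known S) (known S1)
  sSS1 p z y p_pr z_prim
  (introT (knownP _ _) Kz) Kyp K1y _ n v Kv inj_v.
- rewrite /S1 -yA; apply: (adjoin_root_polynomial z_prim) Kyp; exact/knownP.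
- by move=> eqG; case/eqP: neqG; apply/val_inj.
exists (gal (known S1) v :: t); split.
  by rewrite /cyclic_series /= nG cG.
move=> [|k] /=; last exact: pt.
by move=> _; rewrite /level_index /level_group /= -card_quotient ?normal_norm
  ?oG.
Qed.

End Radicals.

(** Irreducibility forces [A] to be nonzero, since otherwise the polynomial is ['X] times a power of
    ['X]. All roots of the equation are adjoined, and [z] is the quotient of [z * y] by [y]. *)
Lemma adjunction_primitive_root (L : closedFieldType) (S : L -> Prop) s p :
  [pchar L] =i pred0 -> irreducible_adjunctions S s -> p \in unzip1 s ->
  exists2 z, p.-primitive_root z & z \in known (adjoin S s).
Proof.
move=> char0 + /mapP[[q A] /= qs pq]; rewrite {p}pq.
case/splitPr: qs => s1 s2 /irreducible_adjunctions_cat[_ /= [q_pr _ [_ _ irr]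
  _]].
have q_gt0 := prime_gt0 q_pr.
have [z z_prim] := primitive_root_exists char0 q_gt0.
have [y yA] := closed_exp_exists A q_gt0.
exists z => //; rewrite adjoin_cat /=; apply: known_sub_adjoin.
pose S1 x := adjoin S s1 x \/ x ^+ q = A.
have Kroot x : x ^+ q = A -> x \in known S1.
  by move=> xA; apply/knownP/rational_gen; right.
have nzy : y != 0.
  apply/eqP => y0; apply: irr; exists 'X, 'X^(q.-1).
  have A0 : A = 0 by rewrite -yA y0 expr0n gtn_eqF.
  rewrite A0 subr0 size_polyX !size_polyXn; split.
  - by move=> i; rewrite coefX; apply/knownP/rpred_nat.
  - by move=> i; rewrite coefXn; apply/knownP/rpred_nat.
  - by rewrite ltnS prime_gt1.
  - by rewrite prednK.
  by rewrite -exprS prednK.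
rewrite -(mulfK nzy z); apply: (@rpred_div _ (known S1)); apply: Kroot => //.
by rewrite exprMn (prim_expr_order z_prim) mul1r.
Qed.

(** * The first adjunction that reduces [q] *)

Section OneAdjunction.
Variables (L : closedFieldType) (char0 : [pchar L] =i pred0).
Variables (n : nat) (P : {poly L}) (r : 'I_n -> L) (P_roots : roots_of P r).
Variables (S : L -> Prop) (a : 'I_n -> L) (q : {poly L}).
Variables (s : seq (nat * L)) (p : nat) (A : L).
Let known0 x := coefs P x \/ S x.
Let K0 := rational known0.
Let K1 := rational (adjoin known0 s).
Let K2 := rational (adjoin known0 (rcons s (p, A))).
Hypothesis resolvent_a : is_resolvent K0 r a.
Hypothesis q_factor : q %| auxiliary_poly r a.
Hypothesis inc_s : increasing_adjunctions known0 (rcons s (p, A)).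
Hypothesis smaller : forall s', increasing_adjunctions known0 s' ->
  all (fun e => (e.1 < p)%N) s' ->
  irreducible_over (rational (adjoin known0 s')) q.
Hypotheses (irr1 : irreducible_over K1 q) (red2 : ~ irreducible_over K2 q).

Let k0 := known known0.
Let k1 := known (adjoin known0 s).
Let k2 := known (adjoin known0 (rcons s (p, A))).

Let Ka i : a i \in k0.
Proof. by apply/knownP; apply: resolvent_a.1. Qed.

Let inj_theta : injective (fun t : 'S_n => linear_function a (arrange t r)).
Proof. exact: resolvent_a.2. Qed.

Let K0r : \prod_i ('X - (r i)%:P) \is a polyOver k0.
Proof.
by apply: roots_of_polyOver P_roots _; apply: coefs_polyOver => x; left.
Qed.

Let inj_r : injective r. Proof. by case: P_roots. Qed.

Let sub01 : {subset k0 <= k1}. Proof. exact: known_sub_adjoin. Qed.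

Let sub12 : {subset k1 <= k2}.
Proof. by rewrite /k2 -cats1 adjoin_cat; apply: known_sub_adjoin. Qed.

Let irr0 : irreducible_over K0 q.
Proof. exact: (@smaller [::] (conj I isT) isT). Qed.

Let sq : (1 < size q)%N. Proof. by case: irr0. Qed.

Let K0q : q \is a polyOver k0.
Proof. by apply/polyOver_coefs_in; rewrite knownE; case: irr0. Qed.

Let irreducible_size (K : divringClosed L) : {subset k0 <= K} ->
  irreducible_over (fun x => is_true (x \in K)) q <-> size q = #|gal K r|.+1.
Proof.
move=> sK; apply: irreducible_auxiliary_factor q_factor => //.
- exact: polyOverS sK _ K0r.
- by move=> i; apply: sK.
exact: polyOverS sK _ K0q.
Qed.

Let eq_gal_irreducible (K : divringClosed L) : {subset k0 <= K} ->
  irreducible_over (fun x => is_true (x \in K)) q ->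
  gal k0 r = gal K r :> {set _}.
Proof.
move=> sK /(irreducible_size sK) sizeK; apply/eqP;
  rewrite eq_sym eqEcard gal_sub //=.
have /(irreducible_size (fun x => id)) size0 :
  irreducible_over (fun x => is_true (x \in k0)) q by rewrite knownE.
by rewrite -ltnS -size0 sizeK.
Qed.

(* If p occurs among the adjunctions made so far, then so do its roots of     *)
(* unity; otherwise all of these adjunctions can be refined to adjunctions    *)
(* with primes smaller than p, which by assumption do not reduce q.           *)
Lemma prime_root_irreducible : exists z (M : L -> Prop),
  [/\ p.-primitive_root z, z \in known M, {subset k1 <= known M} &
      irreducible_over (rational M) q].
Proof.
have [irr_s sorted_s] := inc_s.
have [sorted_s1 le_p] := sorted_unzip1_rcons sorted_s.
move: irr_s; rewrite -cats1 =>
  /irreducible_adjunctions_cat[irr_s /= [p_pr _ _ _]].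
have [ps|nps] := boolP (p \in unzip1 s).
  have [z z_prim Kz] := adjunction_primitive_root char0 irr_s ps.
  by exists z, (adjoin known0 s); split=> // x.
have lt_s : all (fun e => (e.1 < p)%N) s.
  apply/allP => e es; rewrite ltn_neqAle (allP le_p e es) andbT.
  by apply: contraNneq nps => <-; apply: map_f.
have [s' [ks' ss' ls' sub' [z z_prim Kz]]] :=
  kummer_prime_root char0 p_pr (conj irr_s sorted_s1) lt_s.
exists z, (adjoin known0 s'); split=> //; apply: smaller => //.
by split=> //; apply: kummer_irreducible.
Qed.

Variables (d : nat) (v : 'I_d -> L).
Hypothesis v_roots : roots_of q v \/ roots_of P v.

Let inj_v : injective v. Proof. by case: v_roots => [] []. Qed.

Let K0v : \prod_i ('X - (v i)%:P) \is a polyOver k0.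
Proof.
case: v_roots => [qv|Pv]; first exact: roots_of_polyOver qv K0q.
by apply: roots_of_polyOver Pv _; apply: coefs_polyOver => x; left.
Qed.

Let roots_ofE m Q (w : 'I_m -> L)
  x : roots_of Q w -> root Q x = (x \in codom w).
Proof.
move=> [nzQ _ ->]; rewrite rootZ ?lead_coef_eq0 //.
by rewrite (root_prod_XsubC_fin predT w).
Qed.

Let v_rational i : v i \in rational_image k0 r.
Proof.
case: v_roots => [qv|Pv].
  have : root (auxiliary_poly r a) (v i).
    have /dvdpP[q' ->] := q_factor.
    by rewrite rootM (roots_ofE _ qv) codom_f orbT.
  rewrite /auxiliary_poly (root_prod_XsubC_fin predT) => /imageP[t _ ->].
  apply/rational_imageP; exists (fun x => linear_function a (arrange t x))
    => //.
  by apply: rational_function_arrange; apply: rational_function_linear.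
have : root P (v i) by rewrite (roots_ofE _ Pv) codom_f.
by rewrite (roots_ofE _ P_roots) => /codomP[j ->]; apply: rational_image_id.
Qed.

(** Together with [v_rational]: [r] and [v] generate the same field, since a root of [q] is a
    resolvent value, from which the roots of [P] are recovered. Hence [gal_eqP] transfers statements
    between their groups. *)
Let r_rational (K : divringClosed L) i : {subset k0 <= K} ->
  r i \in rational_image K v.
Proof.
move=> sK; case: v_roots => [qv|Pv].
  have [t qt] := auxiliary_factor_root sq q_factor.
  have := qt; rewrite (roots_ofE _ qv) => /codomP[j tj].
  have [phi Kphi phiE] := resolvent_inversion K0r Ka inj_theta.
  apply/rational_imageP; exists (fun x => (phi (t^-1 i)%g).[x j]).
    apply: rational_function_horner; last exact: ratfun_arg.
    exact: polyOverS sK _ (Kphi _).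
  by rewrite -tj phiE permKV.
have : root P (r i) by rewrite (roots_ofE _ P_roots) codom_f.
by rewrite (roots_ofE _ Pv) => /codomP[j ->]; apply: rational_image_id.
Qed.

Lemma one_adjunction (G H : {group 'S_d}) :
  galois_group K0 v G -> galois_group K2 v H ->
  [/\ galois_group K1 v G, (H <| G)%g, cyclic (G / H)%g & #|(G / H)%g| = p].
Proof.
rewrite -[K0]knownE -[K1]knownE -[K2]knownE.
move=> /galois_group_gal-> /galois_group_gal->.
have [irr_s _] := inc_s; rewrite -cats1 in irr_s.
have /irreducible_adjunctions_cat[_ /= [p_pr K1A _ _]] := irr_s.
have [y yA] := closed_exp_exists A (prime_gt0 p_pr).
have [z [M [z_prim Mz sub1M irrM]]] := prime_root_irreducible.
(* An intermediate field: since [q] is still irreducible over the larger [M], adding [z] keeps the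
   group, and [kummer_step] applies from there to [k2]. *)
pose Sz x := adjoin known0 s x \/ x = z.
have sub1z : {subset k1 <= known Sz}.
  by apply: known_sub => x Sx; apply/rational_gen; left.
have subzM : {subset known Sz <= known M}.
  apply: known_sub => x [Sx|->]; last exact/knownP.
  by apply/knownP/sub1M/knownP/rational_gen.
have sub0z : {subset k0 <= known Sz} by move=> x /sub01/sub1z.
have K2z : z \in k2.
  have [||z' z'_prim K2z'] := @adjunction_primitive_root _ (known0)
    (rcons s (p, A)) p char0.
  - by case: inc_s.
  - by rewrite /unzip1 map_rcons mem_rcons inE eqxx.
  have [i ->] := eq_exp_primitive z'_prim (y := 1) (x := z)
    (etrans (prim_expr_order z_prim) (esym (expr1n _ _))).
  by rewrite mulr1 rpredX.
have subz2 : {subset known Sz <= k2}.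
  apply: known_sub => x [Sx|->]; last exact/knownP.
  by apply/knownP/sub12/knownP/rational_gen.
have gal0z : gal k0 r = gal (known Sz) r :> {set _}.
  have galM : gal k0 r = gal (known M) r :> {set _}.
    apply: eq_gal_irreducible; last by rewrite knownE.
    by move=> x /sub0z/subzM.
  by apply/eqP; rewrite eqEsubset (gal_sub r sub0z)
    andbT galM (gal_sub r subzM).
have galv0z : gal k0 v = gal (known Sz) v.
  apply/val_inj/(gal_eqP char0 sub0z K0v inj_v) => x vx.
  apply: ((gal_eqP char0 sub0z K0r inj_r).1 gal0z).
  exact: (rational_image_sub v_rational) vx.
have Kzv := polyOverS sub0z K0v; have Kzr := polyOverS sub0z K0r.
(* An unchanged group of [v] would mean an unchanged group of [r], and then the degree criterion
   would keep [q] irreducible over [K2]. *)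
have neq_gal : gal (known Sz) v <> gal k2 v :> {set _}.
  move=> eq_gal; apply: red2; rewrite -[K2]knownE.
  apply/(irreducible_size (fun x k0x => subz2 x (sub0z x k0x))).
  have [irrE _] := irreducible_size (fun x => id).
  rewrite irrE ?knownE //; congr (_.+1).
  have gal_zr : gal (known Sz) r = gal k2 r :> {set _}.
    apply/(gal_eqP char0 subz2 Kzr inj_r) => x rx.
    apply: ((gal_eqP char0 subz2 Kzv inj_v).1 eq_gal).
    exact: (rational_image_sub (fun i => r_rational i sub0z)) rx.
  by rewrite /= gal0z gal_zr.
have K2y : y \in k2.
  by apply/knownP/rational_gen; rewrite -cats1 adjoin_cat /=; right.
have Kzz : z \in known Sz by apply/knownP/rational_gen; right.
have Kzyp : y ^+ p \in known Sz by rewrite yA; apply/sub1z/knownP.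
have K2gen x : x \in k2 -> exists2 C, C \is a polyOver (known Sz) & x = C.[y].
  move=> K2x; apply: (adjoin_root_polynomial z_prim Kzz Kzyp).
  move: K2x; rewrite /k2 -cats1 adjoin_cat /=; apply: known_sub => t [St|tA].
    by apply: rational_gen; left; left.
  by apply: rational_gen; right; rewrite yA.
have [nH cH oH] := kummer_step char0 subz2 p_pr z_prim Kzz Kzyp K2y K2gen Kzv
  inj_v neq_gal.
rewrite -galv0z in nH cH oH; split=> //.
have -> : gal k0 v = gal k1 v; last exact: gal_galois_group.
by apply/val_inj/eqP; rewrite /= eqEsubset (gal_sub v sub01) andbT
  [gal_set k0 v](congr1 val galv0z) (gal_sub v sub1z).
Qed.

End OneAdjunction.

Theorem mainTheorem1 (L : closedFieldType) (char0 : [pchar L] =i pred0)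
    (n : nat) (P : {poly L}) (r : 'I_n -> L) (P_roots : roots_of P r)
    (Q : {group 'S_n}) (Q_galois : galois_group (rational (coefs P)) r Q) :
  [/\ (* (1) *)
      forall s : seq {group 'S_n}, cyclic_series Q s -> tower_solution P r Q s,
      (* (2), one adjunction: S is any set of previously adjoined quantities,
         s the adjunctions made so far with primes in increasing order, and
         (p, A) the first one that reduces q; no adjunctions with primes
         smaller than p reduce q *)
      forall (S : L -> Prop) (a : 'I_n -> L) (q : {poly L})
             (s : seq (nat * L)) (p : nat) (A : L),
        let known0 := fun x => coefs P x \/ S x in
        let K0 := rational known0 in
        let K1 := rational (adjoin known0 s) in
        let K2 := rational (adjoin known0 (rcons s (p, A))) in
        is_resolvent K0 r a ->
        q %| auxiliary_poly r a ->
        increasing_adjunctions known0 (rcons s (p, A)) ->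
        (forall s', increasing_adjunctions known0 s' ->
           all (fun e => (e.1 < p)%N) s' ->
           irreducible_over (rational (adjoin known0 s')) q) ->
        irreducible_over K1 q ->
        ~ irreducible_over K2 q ->
        (* v lists the roots of q or those of P *)
        forall (d : nat) (v : 'I_d -> L) (G H : {group 'S_d}),
          roots_of q v \/ roots_of P v ->
          galois_group K0 v G -> galois_group K2 v H ->
          [/\ galois_group K1 v G, (H <| G)%g, cyclic (G / H)%g
            & #|(G / H)%g| = p],
      (* (2), every solution in radicals is of the form in (1) *)
      (forall i, radical (coefs P) (r i)) ->
        exists s : seq {group 'S_n},
          [/\ cyclic_series Q s,
              forall k, (k < size s)%N -> prime (level_index Q s k)
            & tower_solution P r Q s]
    & (* (2), unsolvability *)
      (forall s : seq {group 'S_n}, ~~ cyclic_series Q s) ->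
        ~ (forall i, radical (coefs P) (r i))].
Proof.
have QE : Q = gal (known (coefs P)) r.
  by apply: galois_group_gal; rewrite knownE.
have inj_r : injective r by case: P_roots.
have solvable_series : (forall i, radical (coefs P) (r i)) ->
    exists s : seq {group 'S_n}, cyclic_series Q s /\
      forall k, (k < size s)%N -> prime (level_index Q s k).
  move=> /(radicals_kummer char0)[s ks known_r]; rewrite QE.
  apply: kummer_cyclic_series ks known_r => //.
  by apply: roots_of_polyOver P_roots _; apply: coefs_polyOver.
split.
- by move=> s; apply: cyclic_series_tower_solution.
- move=> S a q s p A known0 K0 K1 K2 res_a qPsi inc_s smaller irr1 red2 d v G H
  v_roots.
  exact: (one_adjunction char0 P_roots res_a qPsi inc_s smaller irr1 red2
    v_roots).
- move=> /solvable_series[s [Qs prime_s]]; exists s; split=> //.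
  exact: cyclic_series_tower_solution.
by move=> no_series /solvable_series[s [Qs _]]; have := no_series s; rewrite Qs.
Qed.
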